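(* Let $q_1,\dots,q_m\in\Delta_n$ and let $F(\mathbf x,\mathbf y)$ be the objective of the saddle-point form of the Wasserstein barycenter problem, $$\min_{\mathbf x\in\mathcal X}\max_{\mathbf y\in\mathcal Y}F(\mathbf x,\mathbf y)=\frac1m\sum_{i=1}^m\left\{d^\top x_i+2\|d\|_\infty\left(y_i^\top Ax_i-\begin{pmatrix}p \\ q_i\end{pmatrix}^{\!\top}y_i\right)\right\},$$ where $\mathbf x=(x_1,\dots,x_m,p)\in\mathcal X=\prod^m\Delta_{n^2}\times\Delta_n$ and $\mathbf y=(y_1,\dots,y_m)\in\mathcal Y=[-1,1]^{2mn}$. Assume that $F$ is $\big(0,\,2\sqrt2\|d\|_\infty/m,\,2\sqrt2\|d\|_\infty/m,\,0\big)$-smooth and $R_{\mathcal X}=\sqrt{3m\log n}$, $R_{\mathcal Y}=\sqrt{mn}$. Then after $N=8\|d\|_\infty\sqrt{6n\log n}/\varepsilon$ iterations, the mirror prox algorithm (described in the context) with $\eta=\frac1{4\|d\|_\infty\sqrt{6n\log n}}$ outputs a pair $(\widetilde{\mathbf u},\widetilde{\mathbf v})\in\mathcal X\times\mathcal Y$ such that $$\max_{\mathbf y\in\mathcal Y}F(\widetilde{\mathbf u},\mathbf y)-\min_{\mathbf x\in\mathcal X}F(\mathbf x,\widetilde{\mathbf v})\le\varepsilon.$$ The total complexity of the algorithm is $O\left(mn^2\sqrt{n\log n}\,\|d\|_\infty\varepsilon^{-1}\right)$.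
   Context: $\Delta_k$ is the probability simplex in $\mathbb{R}^k$. $d\in\mathbb{R}_+^{n^2}$ is the vectorized cost matrix $C\in\mathbb{R}_+^{n\times n}$, $\|d\|_\infty$ its largest entry; $A\in\{0,1\}^{2n\times n^2}$ is the incidence matrix mapping a vectorized plan $\pi\in\mathbb{R}^{n\times n}$ to $(\pi\mathbf 1,\pi^\top\mathbf 1)$. $\mathcal Y$ carries the norm $\|\cdot\|_2$, prox-function $d_{\mathcal Y}(\mathbf y)=\frac12\|\mathbf y\|_2^2$ and Bregman divergence $B_{\mathcal Y}(\mathbf y,\breve{\mathbf y})=\frac12\|\mathbf y-\breve{\mathbf y}\|_2^2$. $\mathcal X$ carries the norm $\|\mathbf x\|_{\mathcal X}=\sqrt{\sum_i\|x_i\|_1^2+m\|p\|_1^2}$, prox-function $d_{\mathcal X}(\mathbf x)=\sum_i\langle x_i,\log x_i\rangle+m\langle p,\log p\rangle$ and its Bregman divergence $B_{\mathcal X}$. $R_{\mathcal X}^2=\sup_{\mathcal X}d_{\mathcal X}-\min_{\mathcal X}d_{\mathcal X}$, $R_{\mathcal Y}^2=\sup_{\mathcal Y}d_{\mathcal Y}-\min_{\mathcal Y}d_{\mathcal Y}$. $F$ is $(L_{\mathbf{xx}},L_{\mathbf{xy}},L_{\mathbf{yx}},L_{\mathbf{yy}})$-smooth if for all $\mathbf x,\mathbf x'\in\mathcal X$, $\mathbf y,\mathbf y'\in\mathcal Y$: $\|\nabla_{\mathbf x}F(\mathbf x,\mathbf y)-\nabla_{\mathbf x}F(\mathbf x',\mathbf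 y)\|_{\mathcal X^*}\le L_{\mathbf{xx}}\|\mathbf x-\mathbf x'\|_{\mathcal X}$, $\|\nabla_{\mathbf x}F(\mathbf x,\mathbf y)-\nabla_{\mathbf x}F(\mathbf x,\mathbf y')\|_{\mathcal X^*}\le L_{\mathbf{xy}}\|\mathbf y-\mathbf y'\|_2$, $\|\nabla_{\mathbf y}F(\mathbf x,\mathbf y)-\nabla_{\mathbf y}F(\mathbf x,\mathbf y')\|_2\le L_{\mathbf{yy}}\|\mathbf y-\mathbf y'\|_2$, $\|\nabla_{\mathbf y}F(\mathbf x,\mathbf y)-\nabla_{\mathbf y}F(\mathbf x',\mathbf y)\|_2\le L_{\mathbf{yx}}\|\mathbf x-\mathbf x'\|_{\mathcal X}$, with $\|\cdot\|_{\mathcal X^*}$ the dual norm. Mirror prox: let $\mathcal Z=\mathcal X\times\mathcal Y$, $\mathbf z=(\mathbf x,\mathbf y)$, $B_{\mathcal Z}=R_{\mathcal X}^{-2}B_{\mathcal X}+R_{\mathcal Y}^{-2}B_{\mathcal Y}$, $G=(\nabla_{\mathbf x}F,-\nabla_{\mathbf y}F)$; start from $\mathbf z^0$ with all $x_i=\frac1{n^2}\mathbf 1$, $p=\frac1n\mathbf 1$, $y_i=0$, and for $k=0,\dots,N-1$ set $(\mathbf u^{k+1},\mathbf v^{k+1})=\arg\min_{\mathbf z\in\mathcal Z}\{\eta G(\mathbf z^k)^\top\mathbf z+B_{\mathcal Z}(\mathbf z,\mathbf z^k)\}$ and $\mathbf z^{k+1}=\arg\min_{\mathbf z\in\mathcal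 Z}\{\eta G(\mathbf u^{k+1},\mathbf v^{k+1})^\top\mathbf z+B_{\mathcal Z}(\mathbf z,\mathbf z^k)\}$ (both steps have closed forms: normalized exponential updates for $x_i,p$ and clipped gradient steps for $y_i$). Output: $\widetilde{\mathbf u}=\frac1N\sum_{k=1}^N\mathbf u^k$, $\widetilde{\mathbf v}=\frac1N\sum_{k=1}^N\mathbf v^k$. Complexity counts arithmetic operations. *)

(* Defs.v *)
From HB Require Import structures.
From mathcomp Require Import all_boot all_order all_algebra.
From mathcomp Require Import all_classical all_reals all_analysis.

Set Implicit Arguments.
Unset Strict Implicit.
Unset Printing Implicit Defensive.

Import Order.TTheory GRing.Theory Num.Theory.
Import numFieldNormedType.Exports.

Local Open Scope classical_set_scope.
Local Open Scope ring_scope.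

(* All vectors are row vectors; a family of m vectors of R^k is an m x k matrix,
   whose row i is the i-th vector.  Thus x = (x_1, .., x_m, p) is a pair
   (matrix of the x_i, p), and y = (y_1, .., y_m) is an m x 2n matrix. *)
Notation primal R m n := ('M[R]_(m, (n * n)%N) * 'rV[R]_n)%type.
Notation dual R m n := ('M[R]_(m, (n + n)%N)).
Notation point R m n := (primal R m n * dual R m n)%type.

Section Problem.
Variable R : realType.

Definition simplex k : set 'rV[R]_k :=
  [set p | (forall j, 0 <= p 0 j) /\ \sum_j p 0 j = 1].

Definition mxdot a b (u v : 'M[R]_(a, b)) : R := \sum_i \sum_j u i j * v i j.

Variables m n : nat.

Definition Xset : set (primal R m n) :=
  [set x | (forall i, simplex (row i x.1)) /\ simplex x.2].

Definition Yset : set (dual R m n) := [set y | forall i j, -1 <= y i j <= 1].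

(* The first n rows are indexed by the rows of a plan, the last n by its
   columns; plans are vectorized by mxvec. *)
Definition incidence : 'M[R]_(n + n, n * n) :=
  \matrix_(k, l)
    (match fintype.split k with
     | inl i => [exists j, l == mxvec_index i j]
     | inr j => [exists i, l == mxvec_index i j]
     end)%:R.

(* The entries of C are assumed nonnegative wherever this is used. *)
Definition max_entry (C : 'M[R]_n) : R := \big[Num.max/0]_j mxvec C 0 j.

Definition objective (C : 'M[R]_n) (q : 'M[R]_(m, n))
    (x : primal R m n) (y : dual R m n) : R :=
  m%:R^-1 * \sum_(i < m)
    (mxdot (mxvec C) (row i x.1)
     + 2 * max_entry C * (mxdot (row i y) (row i x.1 *m incidence^T)
                          - mxdot (row_mx x.2 (row i q)) (row i y))).

Definition pdot (x x' : primal R m n) : R := mxdot x.1 x'.1 + mxdot x.2 x'.2.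

Definition gradX (f : primal R m n -> R) (x : primal R m n) : primal R m n :=
  (\matrix_(i, j) 'D_(delta_mx i j, 0) f x, \row_j 'D_(0, delta_mx 0 j) f x).

Definition gradY (f : dual R m n -> R) (y : dual R m n) : dual R m n :=
  \matrix_(i, j) 'D_(delta_mx i j) f y.

Definition normY (y : dual R m n) : R := Num.sqrt (\sum_i \sum_j y i j ^+ 2).

Definition normX (x : primal R m n) : R :=
  Num.sqrt (\sum_i (\sum_j `|x.1 i j|) ^+ 2 + m%:R * (\sum_j `|x.2 0 j|) ^+ 2).

Definition dX (x : primal R m n) : R :=
  \sum_i \sum_j x.1 i j * ln (x.1 i j) + m%:R * \sum_j x.2 0 j * ln (x.2 0 j).

Definition dY (y : dual R m n) : R := 2^-1 * normY y ^+ 2.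

(* Meaningful when x' has positive coordinates, where dX is differentiable;
   x may lie on the boundary of Xset, with 0 * ln 0 = 0. *)
Definition BX (x x' : primal R m n) : R :=
  dX x - dX x' - pdot (gradX dX x') (x - x').

Definition BY (y y' : dual R m n) : R := 2^-1 * normY (y - y') ^+ 2.

Definition RX : R := Num.sqrt (sup (dX @` Xset) - inf (dX @` Xset)).

Definition RY : R := Num.sqrt (sup (dY @` Yset) - inf (dY @` Yset)).

(* The linear space parallel to the affine hull of Xset. *)
Definition directions : set (primal R m n) :=
  [set v : primal R m n | (forall i, \sum_j v.1 i j = 0) /\ \sum_j v.2 0 j = 0].

(* The norm dual to normX on the space V: V = setT gives the dual norm on the
   whole ambient space, V = directions the dual norm on the space in which Xset
   is full-dimensional.  A smoothness assumption is weakest for V = directions.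
   With V = setT the optimal L_xy constant of the barycenter objective is
   2 * max_entry C / m * sqrt ((3 + sqrt 5) / 2), which is larger than
   2 * sqrt 2 * max_entry C / m; with V = directions it is smaller. *)
Definition dual_normX (V : set (primal R m n)) (s : primal R m n) : R :=
  sup [set pdot s v | v in [set v | V v /\ normX v <= 1]].

Definition smooth (V : set (primal R m n))
    (F : primal R m n -> dual R m n -> R) (Lxx Lxy Lyx Lyy : R) : Prop :=
  forall x x' y y', Xset x -> Xset x' -> Yset y -> Yset y' ->
  [/\ dual_normX V (gradX (F^~ y) x - gradX (F^~ y) x') <= Lxx * normX (x - x'),
      dual_normX V (gradX (F^~ y) x - gradX (F^~ y') x) <= Lxy * normY (y - y'),
      normY (gradY (F x) y - gradY (F x) y') <= Lyy * normY (y - y') &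
      normY (gradY (F x) y - gradY (F x') y) <= Lyx * normX (x - x')].

Definition Zset : set (point R m n) := [set z | Xset z.1 /\ Yset z.2].

Definition BZ (z z' : point R m n) : R :=
  RX ^- 2 * BX z.1 z'.1 + RY ^- 2 * BY z.2 z'.2.

Definition zdot (z z' : point R m n) : R := pdot z.1 z'.1 + mxdot z.2 z'.2.

Definition saddle_field (F : primal R m n -> dual R m n -> R)
    (z : point R m n) : point R m n :=
  (gradX (F^~ z.2) z.1, - gradY (F z.1) z.2).

Definition is_argmin T (A : set T) (f : T -> R) (a : T) : Prop :=
  A a /\ forall b, A b -> f a <= f b.

Definition start_point : point R m n :=
  ((const_mx (n%:R ^- 2), const_mx n%:R^-1), 0).

(* w k is (u^k, v^k), used for 1 <= k <= N. *)
Definition mirror_prox_run (F : primal R m n -> dual R m n -> R)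
    (eta : R) (N : nat) (z w : nat -> point R m n) : Prop :=
  z 0%N = start_point /\
  forall k, (k < N)%N ->
    is_argmin Zset (fun b => eta * zdot (saddle_field F (z k)) b + BZ b (z k))
              (w k.+1) /\
    is_argmin Zset (fun b => eta * zdot (saddle_field F (w k.+1)) b + BZ b (z k))
              (z k.+1).

Definition mirror_prox_output (F : primal R m n -> dual R m n -> R)
    (eta : R) (N : nat) (uv : point R m n) : Prop :=
  exists z w, mirror_prox_run F eta N z w /\
    uv = N%:R^-1 *: \sum_(1 <= k < N.+1) w k.

Definition duality_gap (F : primal R m n -> dual R m n -> R)
    (uv : point R m n) : R :=
  sup (F uv.1 @` Yset) - inf ((F^~ uv.2) @` Xset).

End Problem.

(* Arithmetic cost: a value together with the number of arithmetic operations
   spent on it.  Every real operation is performed through one of the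
   primitives below, each of cost 1; literals, indexing and reshaping of arrays
   are free. *)
Definition counted (T : Type) : Type := (T * nat)%type.

Definition ret T (x : T) : counted T := (x, 0%N).

Definition bind S T (c : counted S) (f : S -> counted T) : counted T :=
  ((f c.1).1, (c.2 + (f c.1).2)%N).

Notation "'let*' x := c 'in' b" := (bind c (fun x => b))
  (at level 200, x name, c at level 200, b at level 200).

Section Program.
Variable R : realType.

Definition cadd (x y : R) : counted R := (x + y, 1%N).
Definition csub (x y : R) : counted R := (x - y, 1%N).
Definition cmul (x y : R) : counted R := (x * y, 1%N).
Definition cdiv (x y : R) : counted R := (x / y, 1%N).
Definition cmax (x y : R) : counted R := (Num.max x y, 1%N).
Definition cmin (x y : R) : counted R := (Num.min x y, 1%N).
Definition cexp (x : R) : counted R := (expR x, 1%N).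
Definition cln (x : R) : counted R := (ln x, 1%N).

Definition tabulate a b (f : 'I_a -> 'I_b -> counted R) : counted 'M[R]_(a, b) :=
  (\matrix_(i, j) (f i j).1, (\sum_i \sum_j (f i j).2)%N).

Definition stack a b (f : 'I_a -> counted 'rV[R]_b) : counted 'M[R]_(a, b) :=
  (\matrix_(i < a) (f i).1, (\sum_i (f i).2)%N).

Definition cfold k (op : R -> R -> counted R) (f : 'I_k -> R) : counted R :=
  foldr (fun i c => let* s := c in op (f i) s) (ret 0) (enum 'I_k).

Definition normalize k (v : 'rV[R]_k) : counted 'rV[R]_k :=
  let* s := cfold cadd (v 0) in tabulate (fun _ j => cdiv (v 0 j) s).

Variables m n : nat.

Definition entrywise (op : R -> R -> counted R) (z z' : point R m n) :
    counted (point R m n) :=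
  let* x := tabulate (fun i j => op (z.1.1 i j) (z'.1.1 i j)) in
  let* p := tabulate (fun i j => op (z.1.2 i j) (z'.1.2 i j)) in
  let* y := tabulate (fun i j => op (z.2 i j) (z'.2 i j)) in
  ret ((x, p), y).

(* Closed form of argmin_b { eta G(w)^T b + B_Z(b, z) } for R_X^2 = 3 m ln n and
   R_Y^2 = m n, with alpha = 2 |d| eta n, beta = 6 |d| eta ln n and
   gamma = 3 eta ln n, where |d| is the largest entry of d. *)
Definition prox_step (C : 'M[R]_n) (q : 'M[R]_(m, n)) (alpha beta gamma : R)
    (w z : point R m n) : counted (point R m n) :=
  let* x := stack (fun i : 'I_m =>
    let* W := tabulate (fun k l : 'I_n =>
      let* t := cmul gamma (C k l) in
      let* s := cadd (w.2 i (lshift n k)) (w.2 i (rshift n l)) in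
      let* s := cmul beta s in
      let* t := cadd t s in
      let* t := csub 0 t in
      let* e := cexp t in
      cmul (z.1.1 i (mxvec_index k l)) e) in
    normalize (mxvec W)) in
  let* c := cdiv beta m%:R in
  let* W := tabulate (fun (_ : 'I_1) (j : 'I_n) =>
    let* s := cfold cadd (fun i : 'I_m => w.2 i (lshift n j)) in
    let* t := cmul c s in
    let* e := cexp t in
    cmul (z.1.2 0 j) e) in
  let* p := normalize W in
  let* y := tabulate (fun (i : 'I_m) (k : 'I_(n + n)) =>
    let* s := match fintype.split k with
              | inl a => cfold cadd (fun b => w.1.1 i (mxvec_index a b))
              | inr b => cfold cadd (fun a => w.1.1 i (mxvec_index a b))
              end in
    let* r := csub s (row_mx w.1.2 (row i q) 0 k) in
    let* r := cmul alpha r in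
    let* t := cadd (z.2 i k) r in
    let* t := cmax (-1) t in
    cmin 1 t) in
  ret ((x, p), y).

Definition mirror_prox_algorithm (C : 'M[R]_n) (q : 'M[R]_(m, n)) (eta : R)
    (N : nat) : counted (point R m n) :=
  let* D := cfold cmax (mxvec C 0) in
  let* De := cmul D eta in
  let* L := cln n%:R in
  let* alpha := cmul De n%:R in
  let* alpha := cmul 2 alpha in
  let* beta := cmul De L in
  let* beta := cmul 6 beta in
  let* gamma := cmul eta L in
  let* gamma := cmul 3 gamma in
  let* x0 := cdiv 1 (n * n)%:R in
  let* p0 := cdiv 1 n%:R in
  let* last := iter N
    (fun c : counted (point R m n * point R m n) =>
       let* zS := c in
       let* w := prox_step C q alpha beta gamma zS.1 zS.1 in
       let* z := prox_step C q alpha beta gamma w zS.1 in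
       let* S := entrywise cadd zS.2 w in
       ret (z, S))
    (ret (((const_mx x0, const_mx p0), 0), 0)) in
  entrywise (fun s _ => cdiv s N%:R) last.2 last.2.

End Program.

Section Tuning.
Variable R : realType.

(* The real number of iterations 8 |d| sqrt (6 n ln n) / eps. *)
Definition iteration_bound n (C : 'M[R]_n) (eps : R) : R :=
  8 * max_entry C * Num.sqrt (6 * n%:R * ln n%:R) / eps.

Definition iterations n (C : 'M[R]_n) (eps : R) : nat :=
  `|Num.ceil (iteration_bound C eps)|%N.

Definition step_size n (C : 'M[R]_n) : R :=
  (4 * max_entry C * Num.sqrt (6 * n%:R * ln n%:R))^-1.

End Tuning.

(* Main.v *)
Require Import Defs.
From mathcomp Require Import all_boot all_order all_algebra.
From mathcomp Require Import all_classical all_reals all_analysis.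
From mathcomp Require Import ring lra zify.

Set Implicit Arguments.
Unset Strict Implicit.
Unset Printing Implicit Defensive.

Import Order.TTheory GRing.Theory Num.Theory.
Import numFieldNormedType.Exports.

Local Open Scope classical_set_scope.
Local Open Scope ring_scope.

(** Only the bilinear coupling of F enters: the x-gradient depends on y alone
    and conversely.  With weights R_X^-2 and R_Y^-2, AM-GM together with
    Pinsker's inequality (even with half of its constant) bounds
    eta <G(w) - G(z), w - z'> by B(w, z) + B(z', w), so each extragradient step
    satisfies eta <G(w), w - b> <= B(b, z) - B(b, z').  Since F is affine in each
    variable, <G(w), w - b> is the gap of w against b; telescoping and
    B(b, z^0) <= 2 give the rate.  Both proximal problems have an explicit
    minimizer c with psi(b) >= psi(c) + B(b, c), hence a unique and interior
    one: every run of mirror prox coincides with the program. *)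

(** The constants fit without slack in the x-part. The coupling, which sends [x] to its marginals
    minus [p], has squared operator norm at most 4 from the l1-type norm on X to the Euclidean norm
    on Y. With the radii [3 m ln n] and [m n], the step size then makes AM-GM leave the weight 1/4
    on the squared x-norm, and the inequality [l1^2 <= 4 kl] turns this into exactly one divergence.
    The obstacle on the formal side is that [BX] is defined through directional derivatives, so it
    is informative only when its second argument has positive coordinates. The estimates are
    therefore carried by the explicit divergence [divZ]. A run is given only by argmin conditions,
    and it has to be shown interior, by induction along the run, before [BZ] may be replaced by
    [divZ]. *)

Section Divergence.
Variable R : realType.

(** * Relative entropy and its comparison with the l1 distance *)

Definition kl k (a b : 'I_k -> R) : R := \sum_j a j * (ln (a j) - ln (b j)).

Lemma ln_le_sub1 (x : R) : 0 < x -> ln x <= x - 1.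
Proof.
move=> x0; have := expR_ge1Dx (ln x).
by rewrite lnK ?posrE // => h; lra.
Qed.

(** With [s] and [t] the square roots, this is [ln (t / s) <= t / s - 1] multiplied by [2 s^2]. The
    correction [b - a] disappears after summation over two probability vectors. *)
Lemma sqrt_diff_le_kl_term (a b : R) : 0 <= a -> 0 < b ->
  (Num.sqrt a - Num.sqrt b) ^+ 2 <= a * (ln a - ln b) + b - a.
Proof.
move=> a0 b0.
set s := Num.sqrt a; set t := Num.sqrt b.
have s0 : 0 <= s by exact: sqrtr_ge0.
have t0 : 0 < t by rewrite sqrtr_gt0.
have -> : a = s ^+ 2 by rewrite sqr_sqrtr.
have -> : b = t ^+ 2 by rewrite sqr_sqrtr // ltW.
(* At [a = 0] the factor [a] kills the default value of [ln 0]. *)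
have [->|sn0] := eqVneq s 0.
  by rewrite expr0n /= mul0r; lra.
have sp : 0 < s by rewrite lt_def sn0.
rewrite !lnXn // -(mulr_natl (ln s)) -(mulr_natl (ln t)).
have : ln (t / s) <= t / s - 1 by apply: ln_le_sub1; apply: divr_gt0.
rewrite ln_div ?posrE // => h.
have h2 : s ^+ 2 * (ln t - ln s) <= s ^+ 2 * (t / s - 1).
  by apply: ler_wpM2l => //; exact: sqr_ge0.
have h3 : s ^+ 2 * (t / s - 1) = s * t - s ^+ 2 by field.
rewrite h3 in h2; nra.
Qed.

Section Simplex.
Variables (k : nat) (a b : 'I_k -> R).
Hypotheses (a_ge0 : forall j, 0 <= a j) (b_gt0 : forall j, 0 < b j).
Hypotheses (a_sum1 : \sum_j a j = 1) (b_sum1 : \sum_j b j = 1).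

Lemma hellinger_le_kl :
  \sum_j (Num.sqrt (a j) - Num.sqrt (b j)) ^+ 2 <= kl a b.
Proof.
have -> : kl a b = \sum_j (a j * (ln (a j) - ln (b j)) + b j - a j).
  by rewrite sumrB big_split /= a_sum1 b_sum1 addrK.
by apply: ler_sum => j _; exact: sqrt_diff_le_kl_term.
Qed.

Lemma kl_ge0 : 0 <= kl a b.
Proof.
by apply: le_trans hellinger_le_kl; apply: sumr_ge0 => j _; exact: sqr_ge0.
Qed.

(* Pinsker's inequality with the constant 1/4 instead of 1/2: going through
   the Hellinger distance, only ln x <= x - 1 is needed. *)
Lemma l1_sq_le_kl : (\sum_j `|a j - b j|) ^+ 2 <= 4 * kl a b.
Proof.
set T := \sum_j _.
have T0 : 0 <= T by apply: sumr_ge0.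
set H := \sum_j (Num.sqrt (a j) - Num.sqrt (b j)) ^+ 2.
have HK : H <= kl a b := hellinger_le_kl.
have [->|Tn0] := eqVneq T 0; first by rewrite expr0n /=; have := kl_ge0; lra.
have Tp : 0 < T by rewrite lt_def Tn0.
(* With [d = |u - v|], AM-GM reads [2 d (u + v) <= t d^2 + (u + v)^2 / t], and the [(u + v)^2] sum
   to at most 4. The choice [t = 4 / T] makes the last sum at most [T], so [2 T <= 4 H / T + T]. *)
set t := 4 / T.
have t0 : 0 < t by apply: divr_gt0.
have : \sum_j (2 * `|a j - b j|) <=
    \sum_j (t * (Num.sqrt (a j) - Num.sqrt (b j)) ^+ 2 + t^-1 * (2 * (a j + b j))).
  apply: ler_sum => j _.
  set u := Num.sqrt (a j); set v := Num.sqrt (b j).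
  have u0 : 0 <= u by exact: sqrtr_ge0.
  have v0 : 0 <= v by exact: sqrtr_ge0.
  have -> : a j = u ^+ 2 by rewrite sqr_sqrtr.
  have -> : b j = v ^+ 2 by rewrite sqr_sqrtr // ltW.
  have -> : u ^+ 2 - v ^+ 2 = (u - v) * (u + v) by ring.
  rewrite normrM (ger0_norm (addr_ge0 u0 v0)).
  set d := `|u - v|.
  have -> : (u - v) ^+ 2 = d ^+ 2 by rewrite /d real_normK // num_real.
  have e1 : (u + v) ^+ 2 <= 2 * (u ^+ 2 + v ^+ 2).
    by have := sqr_ge0 (u - v); rewrite !sqrrB !sqrrD; lra.
  have e2 : t^-1 * (u + v) ^+ 2 <= t^-1 * (2 * (u ^+ 2 + v ^+ 2)).
    by apply: ler_wpM2l => //; rewrite invr_ge0 ltW.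
  apply: le_trans (lerD (lexx _) e2).
  have : 0 <= t^-1 * (t * d - (u + v)) ^+ 2.
    by apply: mulr_ge0; [rewrite invr_ge0 ltW|exact: sqr_ge0].
  have -> : t^-1 * (t * d - (u + v)) ^+ 2 =
    t * d ^+ 2 - 2 * (d * (u + v)) + t^-1 * (u + v) ^+ 2 by field; lra.
  by lra.
rewrite -mulr_sumr big_split /= -!mulr_sumr big_split /= a_sum1 b_sum1 -/T -/H.
rewrite /t invf_div => h.
have {h} : T * (2 * T) <= T * (4 / T * H + T / 4 * (2 * (1 + 1))).
  by apply: ler_wpM2l => //; lra.
have -> : T * (4 / T * H + T / 4 * (2 * (1 + 1))) = 4 * H + T ^+ 2 by field.
by nra.
Qed.

Lemma kl_le0_eq : kl a b <= 0 -> a =1 b.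
Proof.
move=> h j.
have h2 := l1_sq_le_kl.
have T0 : (\sum_j `|a j - b j|) ^+ 2 <= 0 by lra.
have : (\sum_j `|a j - b j|) ^+ 2 == 0 by rewrite eq_le T0 sqr_ge0.
rewrite sqrf_eq0 psumr_eq0 // => /allP /(_ j (mem_index_enum _)) /=.
by rewrite normr_eq0 subr_eq0 => /eqP.
Qed.

End Simplex.

Lemma kl_refl k (a : 'I_k -> R) : kl a a = 0.
Proof. by rewrite /kl big1 // => j _; rewrite subrr mulr0. Qed.

(** * Explicit proximal maps on a simplex and on an interval *)

Definition entropic_prox k (h z : 'I_k -> R) (j : 'I_k) : R :=
  z j * expR (- h j) / \sum_j z j * expR (- h j).

Section EntropicProx.
Variables (k : nat) (h z : 'I_k -> R).
Hypotheses (z_gt0 : forall j, 0 < z j) (z_sum1 : \sum_j z j = 1).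

Let S := \sum_j z j * expR (- h j).

Lemma entropic_prox_mass_gt0 : 0 < S.
Proof.
have p j : 0 < z j * expR (- h j) by rewrite mulr_gt0 ?expR_gt0.
rewrite lt_def sumr_ge0 ?andbT => [|j _]; last exact: ltW.
apply/eqP => /eqP; rewrite psumr_eq0 => [/allP h0|j _]; last exact: ltW.
have : \sum_j z j = 0.
  apply: big1 => j _; have /= := h0 j (mem_index_enum _).
  by rewrite gt_eqF.
by rewrite z_sum1 => /eqP; rewrite oner_eq0.
Qed.

Lemma entropic_prox_gt0 j : 0 < entropic_prox h z j.
Proof. by rewrite divr_gt0 ?mulr_gt0 ?expR_gt0 ?entropic_prox_mass_gt0. Qed.

Lemma entropic_prox_sum1 : \sum_j entropic_prox h z j = 1.
Proof. by rewrite -mulr_suml divff // gt_eqF // entropic_prox_mass_gt0. Qed.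

(** Since [ln] of the prox point is [ln z - h - ln S], the proximal objective is, up to a constant,
    the divergence to the prox point. Hence the three-point relation below is an equality. *)
Lemma entropic_prox_kl (b : 'I_k -> R) : \sum_j b j = 1 ->
  \sum_j h j * b j + kl b z = kl b (entropic_prox h z) - ln S.
Proof.
move=> b1; have S0 := entropic_prox_mass_gt0.
rewrite -[in ln S](mul1r (ln S)) -b1 mulr_suml -big_split -sumrB /=.
apply: eq_bigr => j _.
rewrite /entropic_prox ln_div ?posrE // ?mulr_gt0 ?expR_gt0 //.
rewrite lnM ?posrE ?expR_gt0 // expRK -/S; ring.
Qed.

Lemma entropic_prox_three_point (b : 'I_k -> R) : \sum_j b j = 1 ->
  \sum_j h j * entropic_prox h z j + kl (entropic_prox h z) z
    + kl b (entropic_prox h z) = \sum_j h j * b j + kl b z.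
Proof.
move=> b1; rewrite !entropic_prox_kl ?entropic_prox_sum1 // kl_refl; ring.
Qed.

End EntropicProx.

Definition clip (t : R) : R := Num.min 1 (Num.max (-1) t).

Lemma clip_itv (t : R) : -1 <= clip t <= 1.
Proof. by rewrite /clip le_min le_max ge_min !lexx /= andbT; lra. Qed.

(** Clipping projects [z - g] onto the interval. The variational inequality of this projection,
    [0 <= (g + c - z) (t - c)], is equivalent to the claim after expanding the squares. *)
Lemma clip_three_point (g z t : R) : -1 <= t <= 1 ->
  g * clip (z - g) + 2^-1 * (clip (z - g) - z) ^+ 2
    + 2^-1 * (t - clip (z - g)) ^+ 2 <= g * t + 2^-1 * (t - z) ^+ 2.
Proof.
move=> /andP[t1 t2].
set c := clip (z - g).
suff : 0 <= (g + c - z) * (t - c) by nra.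
by rewrite /c /clip; case: (leP (-1) (z - g)) => ?; case: (leP 1) => ?; nra.
Qed.

(** * Directional derivatives by restriction to a line *)

Lemma is_derive_xlnx (x v : R) : 0 < x ->
  is_derive (0 : R) (1 : R) (fun h : R => (h * v + x) * ln (h * v + x)) (v * (ln x + 1)).
Proof.
move=> x0.
pose g := fun h : R => h * v + x.
have dg : is_derive (0 : R) (1 : R) g v.
  rewrite /g; apply: is_derive_eq; rewrite ?mulr0 ?scaler0 ?addr0 ?add0r.
  by rewrite /GRing.scale /= mulr1.
have g0 : g 0 = x by rewrite /g mul0r add0r.
have dl : is_derive (0 : R) (1 : R) (@ln R \o g) (x^-1 * v).
  by apply: is_derive1_comp; rewrite g0; exact: is_derive1_ln.
have := is_deriveM dg dl.
rewrite /= g0 => h; apply: (is_derive_eq h).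
rewrite /GRing.scale /=; field; lra.
Qed.

Lemma derive_line (W : normedModType R) (f : W -> R) (a v : W) :
  'D_v f a = 'D_1 (fun h : R => f (h *: v + a)) (0 : R).
Proof.
have E : (fun h : R => h^-1 *: ((f \o shift a) (h *: v) - f a)) =
    (fun h : R => h^-1 *: (((fun h : R => f (h *: v + a)) \o shift 0) (h *: (1 : R))
                           - f (0 *: v + a))).
  by apply/funext => h /=; rewrite addr0 scale0r add0r /GRing.scale /= mulr1.
by rewrite /derive E.
Qed.

Lemma derive_affine (W : normedModType R) (f : W -> R) (a v : W) (c : R) :
  (forall h : R, f (h *: v + a) = h * c + f a) -> 'D_v f a = c.
Proof.
move=> hf; rewrite derive_line.
rewrite (_ : (fun h : R => _) = (fun h => h * c + f a)); last exact/funext.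
have : is_derive (0 : R) (1 : R) (fun h : R => h * c + f a) c.
  apply: is_derive_eq; rewrite ?mulr0 ?scaler0 ?addr0 ?add0r.
  by rewrite /GRing.scale /= mulr1.
by move=> ?; rewrite derive_val.
Qed.

End Divergence.

(** * The barycenter objective as a function affine in each variable *)

Section Problem.
Variables (R : realType) (m n : nat).
Implicit Types (x : primal R m n) (y : dual R m n).

Lemma mxBE a b (u v : 'M[R]_(a, b)) i j : (u - v) i j = u i j - v i j.
Proof. by rewrite !mxE. Qed.

Lemma mxdotZr a b (u v : 'M[R]_(a, b)) (c : R) : mxdot u (c *: v) = c * mxdot u v.
Proof.
rewrite /mxdot mulr_sumr; apply: eq_bigr => i _; rewrite mulr_sumr.
by apply: eq_bigr => j _; rewrite !mxE mulrCA.
Qed.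

Lemma mxdotDr a b (u v w : 'M[R]_(a, b)) : mxdot u (v + w) = mxdot u v + mxdot u w.
Proof.
rewrite /mxdot -big_split; apply: eq_bigr => i _; rewrite -big_split /=.
by apply: eq_bigr => j _; rewrite !mxE mulrDr.
Qed.

Lemma mxdot_row k (u v : 'rV[R]_k) : mxdot u v = \sum_j u 0 j * v 0 j.
Proof. by rewrite /mxdot big_ord1. Qed.

Lemma mxdotC a b (u v : 'M[R]_(a, b)) : mxdot u v = mxdot v u.
Proof. by apply: eq_bigr => i _; apply: eq_bigr => j _; rewrite mulrC. Qed.

Lemma mxdotNr a b (u v : 'M[R]_(a, b)) : mxdot u (- v) = - mxdot u v.
Proof. by rewrite -scaleN1r mxdotZr mulN1r. Qed.

Lemma mxdotBr a b (u v w : 'M[R]_(a, b)) : mxdot u (v - w) = mxdot u v - mxdot u w.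
Proof. by rewrite mxdotDr mxdotNr. Qed.

Lemma mxdotNl a b (u v : 'M[R]_(a, b)) : mxdot (- u) v = - mxdot u v.
Proof. by rewrite mxdotC mxdotNr mxdotC. Qed.

Lemma mxdotBl a b (u v w : 'M[R]_(a, b)) : mxdot (u - v) w = mxdot u w - mxdot v w.
Proof. by rewrite mxdotC mxdotBr !(mxdotC w). Qed.

Lemma mxdot_delta a b (u : 'M[R]_(a, b)) i j : mxdot u (delta_mx i j) = u i j.
Proof.
rewrite /mxdot (bigD1 i) //= (bigD1 j) //= !mxE !eqxx mulr1.
rewrite big1 ?addr0 => [|j' /negPf nj]; last by rewrite !mxE nj andbF mulr0.
rewrite big1 ?addr0 // => i' /negPf ni.
by rewrite big1 // => j' _; rewrite !mxE ni mulr0.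
Qed.

Lemma mxdot0r a b (u : 'M[R]_(a, b)) : mxdot u 0 = 0.
Proof. by rewrite -(scale0r 0) mxdotZr mul0r. Qed.

Lemma pdotZr x x' (c : R) : pdot x (c *: x') = c * pdot x x'.
Proof. by rewrite /pdot /= !mxdotZr mulrDr. Qed.

Lemma pdotDr x x' x'' : pdot x (x' + x'') = pdot x x' + pdot x x''.
Proof. by rewrite /pdot /= !mxdotDr addrACA. Qed.

Lemma pdotBr x x' x'' : pdot x (x' - x'') = pdot x x' - pdot x x''.
Proof. by rewrite /pdot /= !mxdotBr opprD addrACA. Qed.

Lemma pdotBl x x' x'' : pdot (x - x') x'' = pdot x x'' - pdot x' x''.
Proof. by rewrite /pdot /= !mxdotBl opprD addrACA. Qed.

Lemma gradX_affine (f : primal R m n -> R) (g : primal R m n) (c : R) x :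
  (forall x, f x = pdot g x + c) -> gradX f x = g.
Proof.
move=> hf.
have D v : 'D_v f x = pdot g v.
  by apply: derive_affine => h; rewrite !hf pdotDr pdotZr -addrA.
case: g hf D => g1 g2 _ D; congr (_, _); apply/matrixP => i j; rewrite !mxE D.
  by rewrite /pdot /= mxdot_delta mxdot0r addr0.
by rewrite /pdot /= mxdot_delta mxdot0r add0r (ord1 i).
Qed.

Lemma gradY_affine (f : dual R m n -> R) (g : dual R m n) (c : R) y :
  (forall y, f y = mxdot g y + c) -> gradY f y = g.
Proof.
move=> hf; apply/matrixP => i j; rewrite mxE -(mxdot_delta g).
by apply: derive_affine => h; rewrite !hf mxdotDr mxdotZr -addrA.
Qed.

Lemma sum_mxvec_index (f : 'I_(n * n) -> R) :
  \sum_l f l = \sum_a \sum_b f (mxvec_index a b).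
Proof.
rewrite pair_big /=.
rewrite (reindex _ (curry_mxvec_bij n n)) /=.
by apply: eq_bigr => -[a b] _.
Qed.

Lemma mxvec_index_eq (a a' b b' : 'I_n) :
  (mxvec_index a b == mxvec_index a' b') = (a == a') && (b == b').
Proof.
have [g gK _] := curry_mxvec_bij n n.
apply/eqP/andP => [e|[/eqP-> /eqP->]] //.
by have := gK (a', b') isT; rewrite /= -e (gK (a, b) isT) => -[-> ->].
Qed.

Lemma incidence_l (a a' b : 'I_n) :
  incidence R n (lshift n a) (mxvec_index a' b) = (a == a')%:R.
Proof.
rewrite mxE (unsplitK (inl a)); congr (_%:R); congr nat_of_bool.
apply/existsP/eqP => [[j]|->]; last by exists b.
by rewrite mxvec_index_eq => /andP[/eqP].
Qed.

Lemma incidence_r (a b b' : 'I_n) :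
  incidence R n (rshift n b) (mxvec_index a b') = (b == b')%:R.
Proof.
rewrite mxE (unsplitK (inr b)); congr (_%:R); congr nat_of_bool.
apply/existsP/eqP => [[j]|->]; last by exists a.
by rewrite mxvec_index_eq => /andP[_ /eqP].
Qed.

Definition marginals (X : 'M[R]_(m, n * n)) : 'M[R]_(m, n + n) :=
  X *m (incidence R n)^T.

Lemma marginals_l X i a :
  marginals X i (lshift n a) = \sum_b X i (mxvec_index a b).
Proof.
rewrite mxE sum_mxvec_index (bigD1 a) //= [X in _ + X]big1 ?addr0.
  by apply: eq_bigr => b _; rewrite mxE incidence_l eqxx mulr1.
move=> a' na; apply: big1 => b _.
by rewrite mxE incidence_l eq_sym (negPf na) mulr0.
Qed.

Lemma marginals_r X i b :
  marginals X i (rshift n b) = \sum_a X i (mxvec_index a b).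
Proof.
rewrite mxE sum_mxvec_index; apply: eq_bigr => a _.
rewrite (bigD1 b) //= mxE incidence_r eqxx mulr1 [X in _ + X]big1 ?addr0 //.
by move=> b' nb; rewrite mxE incidence_r eq_sym (negPf nb) mulr0.
Qed.

Lemma potentials_sum y i a b : (y *m incidence R n) i (mxvec_index a b) =
  y i (lshift n a) + y i (rshift n b).
Proof.
rewrite mxE big_split_ord /=; congr (_ + _).
  rewrite (bigD1 a) //= incidence_l eqxx mulr1 [X in _ + X]big1 ?addr0 //.
  by move=> a' /negPf na; rewrite incidence_l na mulr0.
rewrite (bigD1 b) //= incidence_r eqxx mulr1 [X in _ + X]big1 ?addr0 //.
by move=> b' /negPf nb; rewrite incidence_r nb mulr0.
Qed.

Lemma mxdot_marginals (X : 'M[R]_(m, n * n)) y :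
  mxdot (marginals X) y = mxdot (y *m incidence R n) X.
Proof.
apply: eq_bigr => i _.
under eq_bigr => k _ do rewrite mxE mulr_suml.
rewrite exchange_big; apply: eq_bigr => l _; rewrite mxE mulr_suml.
by apply: eq_bigr => k _; rewrite mxE; ring.
Qed.

Variables (C : 'M[R]_n) (q : 'M[R]_(m, n)).
Let D := max_entry C.

Definition grad_y x : dual R m n :=
  \matrix_(i, k) (2 * D / m%:R *
    (marginals x.1 i k - row_mx x.2 (row i q) 0 k)).

Definition grad_x y : primal R m n :=
  (\matrix_(i, l) (m%:R^-1 * (mxvec C 0 l + 2 * D * (y *m incidence R n) i l)),
   \row_j (- (2 * D / m%:R) * \sum_i y i (lshift n j))).

Lemma objective_affine_y x y : objective C q x y =
  mxdot (grad_y x) y + m%:R^-1 * \sum_i mxdot (mxvec C) (row i x.1).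
Proof.
rewrite /objective big_split /= mulrDr addrC; congr (_ + _).
rewrite {3}/mxdot !mulr_sumr; apply: eq_bigr => i _.
rewrite !mxdot_row -sumrB !mulr_sumr; apply: eq_bigr => k _.
rewrite !mxE.
rewrite (_ : \sum_j row i x.1 0 j * _ j k = \sum_j x.1 i j * (incidence R n)^T j k).
  by rewrite /D; ring.
by apply: eq_bigr => l _; rewrite mxE.
Qed.

Lemma objective_affine_x x y : objective C q x y =
  pdot (grad_x y) x + - (2 * D / m%:R) * \sum_i \sum_b q i b * y i (rshift n b).
Proof.
rewrite objective_affine_y /pdot.
have -> : mxdot (grad_y x) y = 2 * D / m%:R * mxdot (marginals x.1) y
   - 2 * D / m%:R * \sum_i \sum_j x.2 0 j * y i (lshift n j)
   - 2 * D / m%:R * \sum_i \sum_b q i b * y i (rshift n b).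
  rewrite -!mulrBr -!sumrB /mxdot mulr_sumr; apply: eq_bigr => i _.
  rewrite big_split_ord [in RHS]big_split_ord /=.
  under eq_bigr => j _.
    rewrite mxE row_mxEl mulrBr mulrBl -!mulrA.
    over.
  rewrite sumrB -!mulr_sumr.
  under [X in _ + X]eq_bigr => j _.
    rewrite mxE row_mxEr [row i q 0 j]mxE mulrBr mulrBl -!mulrA.
    over.
  by rewrite sumrB -!mulr_sumr; ring.
rewrite mxdot_marginals.
have -> : mxdot (grad_x y).1 x.1 = m%:R^-1 * (\sum_i mxdot (mxvec C) (row i x.1)) +
    2 * D / m%:R * mxdot (y *m incidence R n) x.1.
  rewrite {1 3}/mxdot !mulr_sumr -big_split; apply: eq_bigr => i _ /=.
  rewrite mxdot_row !mulr_sumr -big_split; apply: eq_bigr => l _ /=.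
  by rewrite !mxE; ring.
have -> : mxdot (grad_x y).2 x.2 =
    - (2 * D / m%:R) * \sum_i \sum_j x.2 0 j * y i (lshift n j).
  rewrite mxdot_row exchange_big mulr_sumr; apply: eq_bigr => j _ /=.
  by rewrite mxE -mulr_sumr; ring.
ring.
Qed.

Lemma saddle_fieldE (z : Defs.point R m n) :
  saddle_field (objective C q) z = (grad_x z.2, - grad_y z.1).
Proof.
congr (_, - _).
  by apply: gradX_affine => x; exact: objective_affine_x.
by apply: gradY_affine => y; exact: objective_affine_y.
Qed.

Lemma zdot_saddle_field (w b : Defs.point R m n) :
  zdot (saddle_field (objective C q) w) (w - b) =
  objective C q w.1 b.2 - objective C q b.1 w.2.
Proof.
rewrite saddle_fieldE /zdot /= pdotBr mxdotNl mxdotBr.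
have := objective_affine_y w.1 w.2; have := objective_affine_y w.1 b.2.
have := objective_affine_x w.1 w.2; have := objective_affine_x b.1 w.2.
by lra.
Qed.

(** Both sides are the mixed second difference [F(x,y) - F(x,y') - F(x',y) + F(x',y')]. It reduces
    every Lipschitz estimate to one about [grad_y]. *)
Lemma grad_x_sub_dot y y' x x' :
  pdot (grad_x y - grad_x y') (x - x') = mxdot (grad_y x - grad_y x') (y - y').
Proof.
rewrite !pdotBr !pdotBl !mxdotBr !mxdotBl.
have := objective_affine_y x y; have := objective_affine_y x y'.
have := objective_affine_y x' y; have := objective_affine_y x' y'.
have := objective_affine_x x y; have := objective_affine_x x y'.
have := objective_affine_x x' y; have := objective_affine_x x' y'.
by lra.
Qed.

End Problem.

(** * Divergences and norms on the two feasible sets *)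

Section Geometry.
Variables (R : realType) (m n : nat).
Implicit Types (x : primal R m n) (y : dual R m n) (z w b : Defs.point R m n).

Lemma XsetP x : Xset x <->
  [/\ forall i j, 0 <= x.1 i j, forall i, \sum_j x.1 i j = 1,
      forall j, 0 <= x.2 0 j & \sum_j x.2 0 j = 1].
Proof.
have rowE i : \sum_j row i x.1 0 j = \sum_j x.1 i j.
  by apply: eq_bigr => j _; rewrite mxE.
split=> [[h1 [h2 h3]]|[h1 h2 h3 h4]].
  split=> // i; last by rewrite -rowE; case: (h1 i).
  by move=> j; case: (h1 i) => /(_ j); rewrite mxE.
by split=> // i; split=> [j|]; rewrite ?rowE ?mxE.
Qed.

Definition interiorX x := (forall i j, 0 < x.1 i j) /\ (forall j, 0 < x.2 0 j).

Definition klX x x' : R :=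
  \sum_i kl (x.1 i) (x'.1 i) + m%:R * kl (x.2 0) (x'.2 0).

Definition l1sqX x : R :=
  \sum_i (\sum_j `|x.1 i j|) ^+ 2 + m%:R * (\sum_j `|x.2 0 j|) ^+ 2.

Lemma l1sqX_le_klX x x' : Xset x -> Xset x' -> interiorX x' ->
  l1sqX (x - x') <= 4 * klX x x'.
Proof.
move=> /XsetP[a1 a2 a3 a4] /XsetP[b1 b2 b3 b4] [i1 i2].
rewrite /l1sqX /klX mulrDr; apply: lerD.
  rewrite mulr_sumr; apply: ler_sum => i _.
  apply: le_trans (l1_sq_le_kl (a1 i) (i1 i) (a2 i) (b2 i)).
  by under eq_bigr => j _ do rewrite !mxE.
rewrite [leRHS]mulrCA ler_wpM2l //.
apply: le_trans (l1_sq_le_kl a3 i2 a4 b4).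
by under eq_bigr => j _ do rewrite !mxE.
Qed.

Lemma klX_ge0 x x' : Xset x -> Xset x' -> interiorX x' -> 0 <= klX x x'.
Proof.
move=> /XsetP[a1 a2 a3 a4] /XsetP[b1 b2 b3 b4] [i1 i2].
rewrite addr_ge0 ?sumr_ge0 ?mulr_ge0 ?kl_ge0 // => i _.
exact: kl_ge0.
Qed.

Lemma klX_le0_eq x x' : (0 < m)%N -> Xset x -> Xset x' -> interiorX x' ->
  klX x x' <= 0 -> x = x'.
Proof.
move=> m0 /XsetP[a1 a2 a3 a4] /XsetP[b1 b2 b3 b4] [i1 i2] h.
have k1 i : 0 <= kl (x.1 i) (x'.1 i) by exact: kl_ge0.
have k2 : 0 <= kl (x.2 0) (x'.2 0) by exact: kl_ge0.
have mR : 0 < m%:R :> R by rewrite ltr0n.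
have s1 : 0 <= \sum_i kl (x.1 i) (x'.1 i) by exact: sumr_ge0.
have s2 : \sum_i kl (x.1 i) (x'.1 i) <= 0.
  by move: h; rewrite /klX; have := mulr_ge0 (ltW mR) k2; lra.
have s3 : kl (x.2 0) (x'.2 0) <= 0.
  by rewrite -(pmulr_rle0 _ mR); move: h; rewrite /klX; lra.
case: x x' {h} a1 a2 a3 a4 b1 b2 b3 b4 i1 i2 k1 k2 s1 s2 s3 => x p [x' p'] /=.
move=> a1 a2 a3 a4 b1 b2 b3 b4 i1 i2 k1 k2 s1 s2 s3.
congr (_, _); apply/matrixP => i j; last first.
  by rewrite (ord1 i); exact: (kl_le0_eq a3 i2).
apply: (kl_le0_eq (a1 i) (i1 i)) => //.
have : \sum_i kl (x i) (x' i) == 0 by rewrite eq_le s1 s2.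
by rewrite psumr_eq0 // => /allP /(_ i (mem_index_enum _)) /= /eqP ->.
Qed.

Lemma is_derive_sum_pointwise k (f : 'I_k -> R -> R) (d : 'I_k -> R) (a v : R) :
  (forall i, is_derive a v (f i) (d i)) ->
  is_derive a v (fun h => \sum_i f i h) (\sum_i d i).
Proof.
move=> h; rewrite (_ : (fun h => _) = \sum_i f i); first exact: is_derive_sum.
by apply/funext => t; rewrite fct_sumE.
Qed.

Lemma gradX_dX x : interiorX x ->
  gradX (@dX R m n) x =
  (\matrix_(i, j) (ln (x.1 i j) + 1), \row_j (m%:R * (ln (x.2 0 j) + 1))).
Proof.
move=> [i1 i2].
have D (v : primal R m n) : 'D_v (@dX R m n) x =
    \sum_i \sum_j v.1 i j * (ln (x.1 i j) + 1) +
    m%:R * \sum_j v.2 0 j * (ln (x.2 0 j) + 1).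
  rewrite derive_line.
  set f := (fun h : R => _).
  have fE : f = (fun h : R => (\sum_i \sum_j
      (h * v.1 i j + x.1 i j) * ln (h * v.1 i j + x.1 i j))) +
     (fun=> m%:R) * (fun h : R => \sum_j
       (h * v.2 0 j + x.2 0 j) * ln (h * v.2 0 j + x.2 0 j)).
    apply/funext => h; rewrite /f /dX /=; congr (_ + _ * _).
      by apply: eq_bigr => i _; apply: eq_bigr => j _; rewrite !mxE.
    by apply: eq_bigr => j _; rewrite !mxE.
  have d1 : is_derive (0 : R) (1 : R) (fun h : R => (\sum_i \sum_j
      (h * v.1 i j + x.1 i j) * ln (h * v.1 i j + x.1 i j)))
      (\sum_i \sum_j v.1 i j * (ln (x.1 i j) + 1)).
    apply: is_derive_sum_pointwise => i; apply: is_derive_sum_pointwise => j.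
    exact: is_derive_xlnx.
  have d2 : is_derive (0 : R) (1 : R) (fun h : R => \sum_j
       (h * v.2 0 j + x.2 0 j) * ln (h * v.2 0 j + x.2 0 j))
       (\sum_j v.2 0 j * (ln (x.2 0 j) + 1)).
    by apply: is_derive_sum_pointwise => j; exact: is_derive_xlnx.
  have := is_deriveD d1 (is_deriveM (is_derive_cst (m%:R : R) (0 : R) (1 : R)) d2).
  rewrite -fE => df; rewrite derive_val.
  by rewrite scaler0 addr0 /GRing.scale.
congr (_, _); apply/matrixP => i j; rewrite !mxE D /=.
  rewrite [X in _ + _ * X]big1 => [|k _]; last by rewrite mxE mul0r.
  rewrite mulr0 addr0.
  have := mxdot_delta (\matrix_(i, j) (ln (x.1 i j) + 1)) i j.
  rewrite mxE /= => <-; apply: eq_bigr => i' _; apply: eq_bigr => j' _.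
  by rewrite !mxE mulrC.
rewrite [X in X + _]big1 ?add0r; last first.
  by move=> i' _; apply: big1 => j' _; rewrite mxE mul0r.
congr (_ * _).
have := mxdot_delta (\row_j (ln (x.2 0 j) + 1)) 0 j.
rewrite mxE /= mxdot_row => <-; apply: eq_bigr => j' _.
by rewrite !mxE mulrC.
Qed.

(** The summand 1 in the gradient [ln + 1] is paired with [x - x'], each block of which sums to
    zero. *)
Lemma BX_klX x x' : Xset x -> Xset x' -> interiorX x' -> BX x x' = klX x x'.
Proof.
move=> /XsetP[a1 a2 a3 a4] /XsetP[b1 b2 b3 b4] h.
rewrite /BX gradX_dX // /pdot /= mxdot_row /mxdot /dX /klX /kl.
have e k (u v : 'I_k -> R) : \sum_j u j = 1 -> \sum_j v j = 1 ->
   \sum_j u j * (ln (u j) - ln (v j)) = \sum_j u j * ln (u j) - \sum_j v j * ln (v j)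
     - \sum_j (ln (v j) + 1) * (u j - v j).
  move=> u1 v1.
  have -> : \sum_j u j * (ln (u j) - ln (v j)) =
     \sum_j u j * (ln (u j) - ln (v j)) - (\sum_j u j - \sum_j v j).
    by rewrite u1 v1; ring.
  by rewrite -!sumrB; apply: eq_bigr => j _; ring.
under [in RHS]eq_bigr => i _ do rewrite e //.
rewrite e // !sumrB.
rewrite [X in _ = _ - X + _](_ : _ = \sum_i \sum_j (\matrix_(i, j) (ln (x'.1 i j) + 1)) i j *
    (x.1 - x'.1) i j); last first.
  by apply: eq_bigr => i _; apply: eq_bigr => j _; rewrite !mxE.
rewrite [X in _ - (_ + X) = _](_ : _ = m%:R * \sum_j (ln (x'.2 0 j) + 1) * (x.2 0 j - x'.2 0 j)).
  by ring.
by rewrite mulr_sumr; apply: eq_bigr => j _; rewrite !mxE; ring.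
Qed.

Definition sqY y : R := \sum_i \sum_j y i j ^+ 2.

Lemma sqY_ge0 y : 0 <= sqY y.
Proof. by do 2!(apply: sumr_ge0 => ? _); exact: sqr_ge0. Qed.

Lemma sqY_eq0 y : sqY y = 0 -> y = 0.
Proof.
move=> /eqP; rewrite psumr_eq0 => [/allP h|i _]; last first.
  by apply: sumr_ge0 => j _; exact: sqr_ge0.
apply/matrixP => i j; have := h i (mem_index_enum _).
rewrite /= psumr_eq0 => [/allP /(_ j (mem_index_enum _))|k _]; last exact: sqr_ge0.
by rewrite /= sqrf_eq0 mxE => /eqP.
Qed.

Lemma BY_sqY y y' : BY y y' = 2^-1 * sqY (y - y').
Proof. by rewrite /BY /normY sqr_sqrtr // sqY_ge0. Qed.

Lemma sum_sqr_le_sqr_sum k (f : 'I_k -> R) : (forall i, 0 <= f i) ->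
  \sum_i f i ^+ 2 <= (\sum_i f i) ^+ 2.
Proof.
move=> f0; rewrite expr2 mulr_suml; apply: ler_sum => i _.
rewrite expr2 ler_wpM2l // (bigD1 i) //= lerDl sumr_ge0 //.
Qed.

(** The Euclidean norm of a marginal is at most its l1 norm, and taking marginals does not increase
    the l1 norm. *)
Lemma sum_marginals_sqr_le (X : 'M[R]_(m, n * n)) i :
  \sum_a marginals X i (lshift n a) ^+ 2 <= (\sum_l `|X i l|) ^+ 2 /\
  \sum_b marginals X i (rshift n b) ^+ 2 <= (\sum_l `|X i l|) ^+ 2.
Proof.
have sq k (f : 'I_k -> R) : (\sum_j f j) ^+ 2 <= (\sum_j `|f j|) ^+ 2.
  by rewrite -[X in X <= _]real_normK ?num_real // lerXn2r ?nnegrE ?sumr_ge0 // ler_norm_sum.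
rewrite sum_mxvec_index; split; [|rewrite exchange_big /=];
  apply: le_trans (sum_sqr_le_sqr_sum _) => [|a]; rewrite ?sumr_ge0 //.
- by apply: ler_sum => a _; rewrite marginals_l.
- by apply: ler_sum => a _; rewrite marginals_r.
Qed.

(** The linear part of [grad_y] without its factor [2 D / m]: the [q] block is replaced by 0 because
    it cancels in differences. *)
Definition coupling x : dual R m n :=
  \matrix_(i, k) (marginals x.1 i k - row_mx x.2 0 0 k).

(** In each row the column marginals contribute [T], and the row marginals minus [p] contribute
    [2 T + 2 P]. The vector [p] enters all [m] rows, which matches its weight [m] in [l1sqX]. *)
Lemma sqY_coupling_le x : sqY (coupling x) <= 4 * l1sqX x.
Proof.
set P := (\sum_j `|x.2 0 j|) ^+ 2.
have P0 : 0 <= P by exact: sqr_ge0.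
have hP : \sum_j x.2 0 j ^+ 2 <= P.
  apply: le_trans (sum_sqr_le_sqr_sum _) => //.
  by apply: ler_sum => j _; rewrite real_normK ?num_real.
have -> : l1sqX x = \sum_i ((\sum_j `|x.1 i j|) ^+ 2 + P).
  by rewrite big_split /= sumr_const card_ord -mulr_natl.
rewrite mulr_sumr; apply: ler_sum => i _.
set T := (\sum_j `|x.1 i j|) ^+ 2.
have : _ <= T /\ _ <= T := sum_marginals_sqr_le x.1 i.
case=> h1 h2.
have T0 : 0 <= T by exact: sqr_ge0.
rewrite big_split_ord /=.
have hr : \sum_(j < n) coupling x i (rshift n j) ^+ 2 <= T.
  apply: le_trans h2; apply: ler_sum => j _.
  by rewrite mxE row_mxEr [X in _ - X]mxE subr0.
have hl : \sum_(j < n) coupling x i (lshift n j) ^+ 2 <= 2 * T + 2 * P.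
  apply: le_trans (_ : 2 * \sum_a marginals x.1 i (lshift n a) ^+ 2 +
     2 * \sum_j x.2 0 j ^+ 2 <= _); last by lra.
  rewrite !mulr_sumr -big_split; apply: ler_sum => j _ /=.
  rewrite mxE row_mxEl.
  set s := marginals _ _ _; set t := x.2 _ _.
  by have := sqr_ge0 (s + t); rewrite sqrrD sqrrB; lra.
by lra.
Qed.

End Geometry.

(** * Values and costs of the counted primitives *)

Section Program.
Variable R : realType.

Lemma cfold_bigE k (op : R -> R -> R) (f : 'I_k -> R) :
  (cfold (fun s t => (op s t, 1%N)) f).1 = \big[op/0]_j f j.
Proof.
transitivity (\big[op/0]_(j <- enum 'I_k) f j); last first.
  by rewrite enumT [index_enum _]unlock.
rewrite /cfold; elim: (enum _) => [|j s IH] /=.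
  by rewrite big_nil.
by rewrite big_cons -IH.
Qed.

Lemma cfold_cost k (op : R -> R -> R) (f : 'I_k -> R) :
  (cfold (fun s t => (op s t, 1%N)) f).2 = k.
Proof.
rewrite /cfold -[RHS](size_enum_ord k); elim: (enum _) => [|j s IH] //=.
by rewrite IH addn1.
Qed.

Lemma cfold_addE k (f : 'I_k -> R) : (cfold (@Defs.cadd R) f).1 = \sum_j f j.
Proof. exact: cfold_bigE. Qed.

Lemma cfold_add_cost k (f : 'I_k -> R) : (cfold (@Defs.cadd R) f).2 = k.
Proof. exact: cfold_cost. Qed.

Lemma bind_cost S T (c : counted S) (f : S -> counted T) :
  (bind c f).2 = (c.2 + (f c.1).2)%N.
Proof. by []. Qed.

Lemma tabulate_cost a b (f : 'I_a -> 'I_b -> counted R) c :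
  (forall i j, (f i j).2 = c) -> (tabulate f).2 = (a * (b * c))%N.
Proof.
move=> h; rewrite /tabulate /=.
under eq_bigr => i _ do under eq_bigr => j _ do rewrite h.
by rewrite !sum_nat_const !card_ord.
Qed.

Lemma stack_cost a b (f : 'I_a -> counted 'rV[R]_b) c :
  (forall i, (f i).2 = c) -> (stack f).2 = (a * c)%N.
Proof.
by move=> h; rewrite /stack /= (eq_bigr _ (fun i _ => h i)) sum_nat_const card_ord.
Qed.

Lemma normalizeE k (v : 'rV[R]_k) j : (normalize v).1 0 j = v 0 j / \sum_j v 0 j.
Proof. by rewrite /normalize /= mxE cfold_addE. Qed.

Lemma normalize_cost k (v : 'rV[R]_k) : (normalize v).2 = (k + k)%N.
Proof.
rewrite /normalize bind_cost cfold_add_cost (@tabulate_cost _ _ _ 1%N) //.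
by rewrite muln1 mul1n.
Qed.

Variables m n : nat.
Implicit Types z w : Defs.point R m n.

Lemma entrywise_cost op z w : (forall s t, (op s t).2 = 1%N) ->
  (entrywise op z w).2 = (m * (n * n) + n + m * (n + n))%N.
Proof.
move=> h; rewrite /entrywise !bind_cost !(@tabulate_cost _ _ _ 1%N) //=.
by lia.
Qed.

(** The exact count is [11 m n^2 + 11 m n + 5 n + 1]. Each of the [2 m n] marginal entries is a sum
    of only [n] terms, so the product with the incidence matrix stays within order [m n^2]. *)
Lemma prox_step_cost C q alpha beta gamma w z : (1 <= m)%N -> (2 <= n)%N ->
  ((prox_step C q alpha beta gamma w z).2 <= 30 * (m * n ^ 2))%N.
Proof.
move=> m1 n2; rewrite /prox_step.
rewrite bind_cost (@stack_cost _ _ _ (n * (n * 7) + (n * n + n * n))%N); last first.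
  by move=> i; rewrite bind_cost normalize_cost (@tabulate_cost _ _ _ 7%N).
rewrite bind_cost bind_cost (@tabulate_cost _ _ _ (m + 3)%N); last first.
  by move=> i j; rewrite bind_cost cfold_add_cost.
rewrite bind_cost normalize_cost bind_cost (@tabulate_cost _ _ _ (n + 5)%N); last first.
  by move=> i k; rewrite bind_cost; case: (fintype.split k) => ?; rewrite cfold_add_cost.
rewrite /=; nia.
Qed.

End Program.

Lemma iter_bind_val S (f : S -> counted S) N (c : counted S) :
  (iter N (fun c => bind c f) c).1 = iter N (fun s => (f s).1) c.1.
Proof. by elim: N => //= N ->. Qed.

Lemma iter_bind_cost S (f : S -> counted S) N (c : counted S) B :
  (forall s, ((f s).2 <= B)%N) ->
  ((iter N (fun c => bind c f) c).2 <= c.2 + N * B)%N.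
Proof.
move=> h; elim: N => [|N IH]; first by rewrite addn0.
by rewrite iterS bind_cost mulSn; have := h (iter N (fun c => bind c f) c).1; lia.
Qed.

(** * The extragradient inequality for one step *)

Section MirrorProx.
Variables (R : realType) (m n : nat) (C : 'M[R]_n) (q : 'M[R]_(m, n)).
Hypotheses (m_gt0 : (1 <= m)%N) (n_gt1 : (2 <= n)%N) (D_gt0 : 0 < max_entry C).
Implicit Types (x : primal R m n) (y : dual R m n) (z w b : Defs.point R m n).

Let D := max_entry C.
Let L : R := ln n%:R.
Let lX : R := 3 * m%:R * L.
Let lY : R := m%:R * n%:R.
Let eta : R := step_size C.
Let F := objective C q.

Let m_pos : 0 < m%:R :> R. Proof. by rewrite ltr0n. Qed.
Let n_pos : 0 < n%:R :> R. Proof. by rewrite ltr0n; lia. Qed.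
Let L_pos : 0 < L. Proof. by rewrite ln_gt0 // ltr1n. Qed.
Let lX_pos : 0 < lX. Proof. by rewrite !mulr_gt0. Qed.
Let lY_pos : 0 < lY. Proof. by rewrite !mulr_gt0. Qed.

Lemma step_size_gt0 : 0 < eta.
Proof. by rewrite invr_gt0 !mulr_gt0 // sqrtr_gt0 !mulr_gt0. Qed.

(** Derivative-free form of [BZ], with the assumed values of the squared radii inserted. *)
Definition divZ b z : R := klX b.1 z.1 / lX + 2^-1 * sqY (b.2 - z.2) / lY.

Definition interiorZ z := Zset z /\ interiorX z.1.

Lemma divZ_ge0 b z : Zset b -> interiorZ z -> 0 <= divZ b z.
Proof.
move=> [b1 _] [[z1 _] iz].
by rewrite addr_ge0 ?divr_ge0 ?mulr_ge0 ?sqY_ge0 ?klX_ge0 // ltW.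
Qed.

Lemma divZ_le0_eq b z : Zset b -> interiorZ z -> divZ b z <= 0 -> b = z.
Proof.
move=> [b1 _] [[z1 _] iz] h.
have k0 := klX_ge0 b1 z1 iz; have s0 := sqY_ge0 (b.2 - z.2).
have h1 : 0 <= klX b.1 z.1 / lX by rewrite divr_ge0 // ltW.
have h2 : 0 <= 2^-1 * sqY (b.2 - z.2) / lY by rewrite divr_ge0 ?mulr_ge0 // ltW.
have e1 : b.1 = z.1.
  apply: klX_le0_eq => //; rewrite -(pmulr_lle0 _ (x := lX^-1)) ?invr_gt0 //.
  by move: h; rewrite /divZ; lra.
have e2 : b.2 = z.2.
  apply/eqP; rewrite -subr_eq0; apply/eqP/sqY_eq0/eqP; rewrite eq_le s0 andbT.
  rewrite -(pmulr_rle0 _ (x := 2^-1)) ?invr_gt0 //.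
  rewrite -(pmulr_lle0 _ (x := lY^-1)) ?invr_gt0 //.
  by move: h; rewrite /divZ; lra.
by rewrite [b]surjective_pairing e1 e2 -surjective_pairing.
Qed.

(* AM-GM with the weights lX and lY; the step size is small enough for the
   constants 4 of [sqY_coupling_le] and [l1sqX_le_klX]. *)
Lemma coupling_bound x x' y : eta * mxdot (grad_y C q x - grad_y C q x') y <=
  4^-1 * l1sqX (x - x') / lX + 2^-1 * sqY y / lY.
Proof.
set c := eta * (2 * D / m%:R).
have E : eta * mxdot (grad_y C q x - grad_y C q x') y = c * mxdot (coupling (x - x')) y.
  rewrite /mxdot !mulr_sumr; apply: eq_bigr => i _.
  rewrite !mulr_sumr; apply: eq_bigr => k _.
  have eM : marginals (x - x').1 i k = marginals x.1 i k - marginals x'.1 i k.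
    by rewrite /marginals /= mulmxBl mxBE.
  rewrite mxBE [grad_y C q x i k]mxE [grad_y C q x' i k]mxE [coupling _ i k]mxE eM /c /D.
  case: (split_ordP k) => j ->.
    by rewrite !row_mxEl !mxE; ring.
  by rewrite !row_mxEr !mxE; ring.
(* This identity is what the value of [eta] is made for: half of it, times the 4 of
   [sqY_coupling_le], is the weight [4^-1 / lX]. *)
have c2 : c ^+ 2 * lY = (8 * lX)^-1.
  rewrite /c /eta /step_size -/D -/L /lX /lY.
  set r := Num.sqrt _.
  have r2 : r ^+ 2 = 6 * n%:R * L by rewrite sqr_sqrtr // !mulr_ge0 // ltW.
  have r0 : r != 0 by rewrite gt_eqF // sqrtr_gt0 !mulr_gt0.
  have -> : ((4 * D * r)^-1 * (2 * D / m%:R)) ^+ 2 * (m%:R * n%:R) =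
     n%:R / (4 * m%:R * r ^+ 2).
    by field; rewrite r0 !gt_eqF.
  by rewrite r2; field; rewrite !gt_eqF.
rewrite E [2^-1 * sqY y / lY]mulrAC.
have h : c * mxdot (coupling (x - x')) y <=
   2^-1 * (c ^+ 2 * lY) * sqY (coupling (x - x')) + 2^-1 / lY * sqY y.
  rewrite /mxdot /sqY !mulr_sumr -big_split /=; apply: ler_sum => i _.
  rewrite !mulr_sumr -big_split /=; apply: ler_sum => k _.
  set s := coupling _ _ _; set t := y i k.
  have : 0 <= 2^-1 / lY * (c * lY * s - t) ^+ 2.
    by rewrite mulr_ge0 ?sqr_ge0 ?divr_ge0 // ltW.
  have -> : 2^-1 / lY * (c * lY * s - t) ^+ 2 =
     2^-1 * (c ^+ 2 * lY) * s ^+ 2 - c * (s * t) + 2^-1 / lY * t ^+ 2.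
    by field; rewrite gt_eqF.
  by lra.
apply: (le_trans h); rewrite lerD2r c2.
have := sqY_coupling_le (x - x'); rewrite -(ler_pM2l (_ : 0 < 2^-1 * (8 * lX)^-1)).
  move=> h2; apply: (le_trans h2); rewrite le_eqVlt; apply/orP; left; apply/eqP.
  by field; rewrite gt_eqF.
by rewrite mulr_gt0 ?invr_gt0 ?mulr_gt0.
Qed.

(** The factor for [p] is [3 L = lX / m], because its entropy has weight [m]. The double minus keeps
    the shape [z - g] of [clip_three_point], as the field contains [- grad_y]. *)
Definition prox w z : Defs.point R m n :=
  ((\matrix_(i, l) entropic_prox (fun l => lX * eta * (grad_x C w.2).1 i l) (z.1.1 i) l,
    \row_j entropic_prox (fun j => 3 * L * eta * (grad_x C w.2).2 0 j) (z.1.2 0) j),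
   \matrix_(i, k) clip (z.2 i k - - (lY * eta * grad_y C q w.1 i k))).

Lemma prox_stepE w z :
  (prox_step C q (2 * (D * eta * n%:R)) (6 * (D * eta * L)) (3 * (eta * L)) w z).1
  = prox w z.
Proof.
congr ((_, _), _); apply/matrixP => i j; rewrite [RHS]mxE.
- rewrite [LHS]mxE; have E l : (mxvec (\matrix_(k, l) (z.1.1 i (mxvec_index k l) *
      expR (0 - (3 * (eta * L) * C k l + 6 * (D * eta * L) *
       (w.2 i (lshift n k) + w.2 i (rshift n l))))))) 0 l =
      z.1.1 i l * expR (- (lX * eta * (grad_x C w.2).1 i l)).
    case: (mxvec_indexP l) => a a'; rewrite mxvecE [LHS]mxE.
    rewrite [(grad_x _ _).1 _ _]mxE potentials_sum mxvecE sub0r.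
    congr (_ * expR (- _)).
    by rewrite /lX -/D; field; rewrite gt_eqF.
  rewrite normalizeE E /entropic_prox; congr (_ / _).
  by apply: eq_bigr => l _; rewrite E.
- have E l : (\matrix_(_ < 1, j < n) (z.1.2 0 j * expR (6 * (D * eta * L) / m%:R *
      (cfold (@Defs.cadd R) (fun i : 'I_m => w.2 i (lshift n j))).1))) 0 l =
      z.1.2 0 l * expR (- (3 * L * eta * (grad_x C w.2).2 0 l)).
    rewrite !mxE cfold_addE; congr (_ * expR _).
    by rewrite -/D; field; rewrite gt_eqF.
  rewrite (ord1 i) normalizeE E /entropic_prox; congr (_ / _).
  by apply: eq_bigr => l _; rewrite E.
- rewrite [LHS]mxE /= /clip; congr (Num.min 1 (Num.max (-1) (_ + _))).
  rewrite opprK [grad_y _ _ _ _ _]mxE.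
  have -> : (match fintype.split j with
              | inl a => cfold (@Defs.cadd R) (fun a' => w.1.1 i (mxvec_index a a'))
              | inr a' => cfold (@Defs.cadd R) (fun a => w.1.1 i (mxvec_index a a'))
              end).1 = marginals w.1.1 i j.
    case: (split_ordP j) => k ->.
      by rewrite cfold_addE marginals_l.
    by rewrite cfold_addE marginals_r.
  by rewrite /lY -/D; field; rewrite gt_eqF.
Qed.

Lemma prox_interior w z : interiorZ z -> interiorZ (prox w z).
Proof.
move=> [[/XsetP[z1 z2 z3 z4] _] [i1 i2]]; split; first split.
- apply/XsetP; split=> [i j|i|j|].
  + by rewrite mxE ltW // entropic_prox_gt0.
  + by under eq_bigr => j _ do rewrite mxE; rewrite entropic_prox_sum1.
  + by rewrite mxE ltW // entropic_prox_gt0.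
  + by under eq_bigr => j _ do rewrite mxE; rewrite entropic_prox_sum1.
- by move=> i j; rewrite mxE; exact: clip_itv.
- by split=> [i j|j]; rewrite mxE entropic_prox_gt0.
Qed.

(** With the weights factored out, the problem separates into one entropic problem per simplex and
    one scalar quadratic problem per entry of [y], in the form of the three-point lemmas. *)
Lemma prox_objectiveE w b z :
  eta * zdot (saddle_field F w) b + divZ b z =
  lX^-1 * (\sum_i (\sum_l lX * eta * (grad_x C w.2).1 i l * b.1.1 i l
                   + kl (b.1.1 i) (z.1.1 i))
     + m%:R * (\sum_j 3 * L * eta * (grad_x C w.2).2 0 j * b.1.2 0 j
               + kl (b.1.2 0) (z.1.2 0)))
  + lY^-1 * \sum_i \sum_k (- (lY * eta * grad_y C q w.1 i k) * b.2 i k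
                           + 2^-1 * (b.2 i k - z.2 i k) ^+ 2).
Proof.
rewrite saddle_fieldE /zdot /pdot /divZ /klX /= mxdotNl.
have -> : \sum_i (\sum_l lX * eta * (grad_x C w.2).1 i l * b.1.1 i l
                   + kl (b.1.1 i) (z.1.1 i)) =
    lX * eta * mxdot (grad_x C w.2).1 b.1.1 + \sum_i kl (b.1.1 i) (z.1.1 i).
  rewrite big_split /=; congr (_ + _); rewrite /mxdot mulr_sumr.
  apply: eq_bigr => i _; rewrite mulr_sumr; apply: eq_bigr => l _; ring.
have -> : \sum_j 3 * L * eta * (grad_x C w.2).2 0 j * b.1.2 0 j =
    3 * L * eta * mxdot (grad_x C w.2).2 b.1.2.
  by rewrite mxdot_row mulr_sumr; apply: eq_bigr => j _; ring.
have -> : \sum_i \sum_k (- (lY * eta * grad_y C q w.1 i k) * b.2 i k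
                           + 2^-1 * (b.2 i k - z.2 i k) ^+ 2) =
    - (lY * eta) * mxdot (grad_y C q w.1) b.2 + 2^-1 * sqY (b.2 - z.2).
  rewrite /mxdot /sqY !mulr_sumr -big_split; apply: eq_bigr => i _ /=.
  rewrite !mulr_sumr -big_split; apply: eq_bigr => k _ /=.
  by rewrite mxBE; ring.
have e : lX = 3 * m%:R * L by [].
rewrite e; field.
by rewrite !gt_eqF.
Qed.

Lemma prox_three_point w z b : interiorZ z -> Zset b ->
  eta * zdot (saddle_field F w) (prox w z) + divZ (prox w z) z + divZ b (prox w z)
  <= eta * zdot (saddle_field F w) b + divZ b z.
Proof.
move=> iz [/XsetP[b1 b2 b3 b4] bY]; have [[/XsetP[z1 z2 z3 z4] _] [i1 i2]] := iz.
rewrite !prox_objectiveE.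
rewrite [divZ b _](_ : _ = lX^-1 * klX b.1 (prox w z).1 +
   lY^-1 * (2^-1 * sqY (b.2 - (prox w z).2))); last first.
  by rewrite /divZ; ring.
rewrite addrACA -!mulrDr; apply: lerD; rewrite ler_pM2l ?invr_gt0 // /klX.
  rewrite addrACA -mulrDr -big_split /=.
  rewrite le_eqVlt; apply/orP; left; apply/eqP; congr (_ + _ * _).
    apply: eq_bigr => i _.
    have E : (prox w z).1.1 i =1
      entropic_prox (fun l => lX * eta * (grad_x C w.2).1 i l) (z.1.1 i).
      by move=> l; rewrite mxE.
    rewrite -(entropic_prox_three_point _ (i1 i) (z2 i) (b2 i)).
    by rewrite (funext E).
  have E : (prox w z).1.2 0 =1
      entropic_prox (fun j => 3 * L * eta * (grad_x C w.2).2 0 j) (z.1.2 0).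
    by move=> l; rewrite mxE.
  rewrite -(entropic_prox_three_point _ i2 z4 b4).
  by rewrite (funext E).
rewrite /sqY mulr_sumr -big_split; apply: ler_sum => i _ /=.
rewrite mulr_sumr -big_split; apply: ler_sum => k _ /=.
rewrite mxBE [(prox w z).2 i k]mxE.
exact: clip_three_point.
Qed.

Lemma zdotBr (g u v : Defs.point R m n) : zdot g (u - v) = zdot g u - zdot g v.
Proof. by rewrite /zdot /= pdotBr mxdotBr; ring. Qed.

Lemma l1sqX_distrC x x' : l1sqX (x - x') = l1sqX (x' - x).
Proof.
rewrite /l1sqX; congr (_ + _ * _ ^+ 2).
  apply: eq_bigr => i _; congr (_ ^+ 2); apply: eq_bigr => j _.
  by rewrite !mxE distrC.
by apply: eq_bigr => j _; rewrite !mxE distrC.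
Qed.

Lemma sqY_distrC y y' : sqY (y - y') = sqY (y' - y).
Proof.
by apply: eq_bigr => i _; apply: eq_bigr => j _; rewrite !mxE -sqrrN opprB.
Qed.

Lemma saddle_field_lipschitz z w z' : interiorZ z -> interiorZ w -> Zset z' ->
  eta * (zdot (saddle_field F w) (w - z') - zdot (saddle_field F z) (w - z'))
  <= divZ w z + divZ z' w.
Proof.
move=> [[Xz _] Iz] [[Xw _] Iw] [X' _].
(* The terms pair crosswise: the x-displacement from [w] to [z'] meets the y-displacement from [z]
   to [w], and conversely. AM-GM on both yields each of the four parts of [divZ w z + divZ z' w]
   once. *)
have -> : zdot (saddle_field F w) (w - z') - zdot (saddle_field F z) (w - z') =
    mxdot (grad_y C q w.1 - grad_y C q z'.1) (w.2 - z.2)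
    + mxdot (grad_y C q z.1 - grad_y C q w.1) (w.2 - z'.2).
  rewrite -grad_x_sub_dot !saddle_fieldE /zdot /= pdotBl mxdotBl !mxdotNl; ring.
have c1 := coupling_bound w.1 z'.1 (w.2 - z.2).
have c2 := coupling_bound z.1 w.1 (w.2 - z'.2).
have k1 : 4^-1 * l1sqX (w.1 - z'.1) / lX <= klX z'.1 w.1 / lX.
  rewrite ler_pM2r ?invr_gt0 // l1sqX_distrC.
  by have := l1sqX_le_klX X' Xw Iw; lra.
have k2 : 4^-1 * l1sqX (z.1 - w.1) / lX <= klX w.1 z.1 / lX.
  rewrite ler_pM2r ?invr_gt0 // l1sqX_distrC.
  by have := l1sqX_le_klX Xw Xz Iz; lra.
rewrite mulrDr /divZ (sqY_distrC z'.2).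
by lra.
Qed.

(** The three-point inequality of the second prox is tested at [b], that of the first at [z']. In
    their sum [divZ z' z] cancels, and [divZ w z + divZ z' w] pays for the Lipschitz term. *)
Lemma mirror_prox_step b z w z' : interiorZ z -> Zset b ->
  w = prox z z -> z' = prox w z ->
  eta * (F w.1 b.2 - F b.1 w.2) <= divZ b z - divZ b z'.
Proof.
move=> iz bZ wE z'E.
have iw : interiorZ w by rewrite wE; exact: prox_interior.
have [Zz' _] : interiorZ z' by rewrite z'E; exact: prox_interior.
have h1 := prox_three_point w iz bZ; have h2 := prox_three_point z iz Zz'.
rewrite -z'E in h1; rewrite -wE in h2.
rewrite -zdot_saddle_field; move: h1 h2 (saddle_field_lipschitz iz iw Zz').
rewrite /F; move: (saddle_field _ w) (saddle_field _ z) => g g'.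
rewrite !zdotBr; move: (divZ b z) (divZ b z') (divZ z' z) (divZ z' w) (divZ w z).
by move=> *; lra.
Qed.

(** * Identification of the argmins and the initial divergence *)

Hypothesis RX_eq : RX R m n = Num.sqrt (3 * m%:R * ln n%:R).
Hypothesis RY_eq : RY R m n = Num.sqrt (m%:R * n%:R).

Lemma BZ_divZ b z : Zset b -> interiorZ z -> BZ b z = divZ b z.
Proof.
move=> [bX _] [[zX _] zI].
rewrite /BZ /divZ RX_eq RY_eq BX_klX // BY_sqY !sqr_sqrtr; last 2 first.
- by rewrite !mulr_ge0 // ltW.
- by rewrite !mulr_ge0 // ltW.
by congr (_ + _); rewrite mulrC.
Qed.

Lemma argmin_prox w z : interiorZ z ->
  is_argmin (@Zset R m n) (fun b => eta * zdot (saddle_field F w) b + BZ b z)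
    (prox w z).
Proof.
move=> iz; have ip : interiorZ (prox w z) by exact: prox_interior.
split=> [|b bZ]; first by case: ip.
rewrite !BZ_divZ //; last by case: ip.
have := prox_three_point w iz bZ; have := divZ_ge0 bZ ip.
by lra.
Qed.

Lemma argmin_prox_unique w z b : interiorZ z ->
  is_argmin (@Zset R m n) (fun b => eta * zdot (saddle_field F w) b + BZ b z) b ->
  b = prox w z.
Proof.
move=> iz [bZ hb]; have ip : interiorZ (prox w z) by exact: prox_interior.
apply: (divZ_le0_eq bZ ip).
have := prox_three_point w iz bZ.
have := hb (prox w z) ip.1.
by rewrite !BZ_divZ //; [lra|case: ip].
Qed.

Lemma start_point_interior : interiorZ (start_point R m n).
Proof.
split; first split.
- apply/XsetP; split=> [i j|i|j|] /=.
  + by rewrite mxE invr_ge0 exprn_ge0.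
  + under eq_bigr => j _ do rewrite mxE.
    rewrite sumr_const card_ord -[LHS]mulr_natr natrM -expr2 mulVf //.
    by rewrite expf_eq0 /= gt_eqF.
  + by rewrite mxE invr_ge0.
  + under eq_bigr => j _ do rewrite mxE.
    by rewrite sumr_const card_ord -[LHS]mulr_natr mulVf // gt_eqF.
- by move=> i j; rewrite mxE; lra.
- by split=> [i j|j] /=; rewrite mxE invr_gt0 ?exprn_gt0.
Qed.

Lemma kl_const_le k (a : 'I_k -> R) (c : R) : (forall j, 0 <= a j) ->
  \sum_j a j = 1 -> kl a (fun=> c) <= - ln c.
Proof.
move=> a0 a1; rewrite -[leRHS]mul1r -a1 mulr_suml; apply: ler_sum => j _.
rewrite mulrBr mulrN gerDr; apply: mulr_ge0_le0 => //; apply: ln_le0.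
by rewrite -a1 (bigD1 j) //= lerDl sumr_ge0.
Qed.

(** Each of the two terms is at most 1. Divergence from a uniform vector is at most the log of its
    dimension: [2 ln n] for each plan and [ln n], with weight [m], for [p]. The [2 m n] entries of
    [y] have squares at most 1. *)
Lemma divZ_start_le b : Zset b -> divZ b (start_point R m n) <= 2.
Proof.
move=> [/XsetP[b1 b2 b3 b4] bY].
have hX : klX b.1 (start_point R m n).1 <= 3 * m%:R * ln n%:R.
  rewrite /klX.
  have -> : 3 * m%:R * ln n%:R = \sum_(i < m) (2 * ln n%:R) + m%:R * ln n%:R :> R.
    by rewrite sumr_const card_ord -[X in _ = X + _]mulr_natl; ring.
  apply: lerD; first apply: ler_sum => i _.
    rewrite (_ : (start_point R m n).1.1 i = fun=> n%:R ^- 2); last first.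
      by apply/funext => j; rewrite mxE.
    apply: le_trans (kl_const_le _ (b1 i) (b2 i)) _.
    by rewrite lnV ?posrE ?exprn_gt0 // opprK lnXn // mulr_natl.
  rewrite ler_wpM2l // (_ : (start_point R m n).1.2 0 = fun=> n%:R^-1); last first.
    by apply/funext => j; rewrite mxE.
  apply: le_trans (kl_const_le _ b3 b4) _.
  by rewrite lnV ?posrE // opprK.
have hY : sqY (b.2 - (start_point R m n).2) <= 2 * (m%:R * n%:R).
  rewrite subr0; apply: le_trans (_ : \sum_(i < m) \sum_(j < n + n) 1 <= _).
    apply: ler_sum => i _; apply: ler_sum => j _.
    by have := bY i j; nra.
  rewrite !sumr_const !card_ord -[X in X <= _]mulr_natl natrD; lra.
have e1 : klX b.1 (start_point R m n).1 / (3 * m%:R * ln n%:R) <= 1.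
  by rewrite ler_pdivrMr ?mul1r // !mulr_gt0.
have e2 : 2^-1 * sqY (b.2 - (start_point R m n).2) / (m%:R * n%:R) <= 1.
  by rewrite ler_pdivrMr ?mul1r ?mulr_gt0 //; lra.
by rewrite /divZ /lX /lY /L; lra.
Qed.

(** * Regret and averaging along an arbitrary run *)

Section Run.
Variables (N : nat) (z w : nat -> Defs.point R m n).
Hypothesis run : mirror_prox_run F eta N z w.

(** Interiority of [z k] gives [BZ _ (z k)] its meaning, which forces the argmin [z k.+1] to be a
    [prox] point, again interior. *)
Lemma run_interior k : (k <= N)%N -> interiorZ (z k).
Proof.
elim: k => [|k IH] kN; first by case: run => -> _; exact: start_point_interior.
have iz := IH (ltnW kN); have [_ /(_ k kN)[_ h]] := run.
by rewrite (argmin_prox_unique iz h); exact: prox_interior.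
Qed.

Lemma run_step k : (k < N)%N ->
  w k.+1 = prox (z k) (z k) /\ z k.+1 = prox (w k.+1) (z k).
Proof.
move=> kN; have iz := run_interior (ltnW kN); have [_ /(_ k kN)[h1 h2]] := run.
by split; exact: argmin_prox_unique.
Qed.

Lemma run_regret K b : (K <= N)%N -> Zset b ->
  eta * (\sum_(1 <= k < K.+1) (F (w k).1 b.2 - F b.1 (w k).2))
  <= divZ b (z 0) - divZ b (z K).
Proof.
move=> + bZ; elim: K => [|K IH] KN; first by rewrite big_geq // mulr0 subrr.
rewrite big_nat_recr //= mulrDr.
have [h1 h2] := run_step KN.
have := mirror_prox_step (run_interior (ltnW KN)) bZ h1 h2.
have := IH (ltnW KN).
by lra.
Qed.

Lemma run_Zset k : (1 <= k < N.+1)%N -> Zset (w k).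
Proof.
case: k => // k /andP[_ kN]; have [-> _] := run_step kN.
by case: (prox_interior (z k) (run_interior (ltnW kN))).
Qed.

Hypothesis N_gt0 : (0 < N)%N.
Let avg := N%:R^-1 *: \sum_(1 <= k < N.+1) w k.

Let N_pos : 0 < N%:R :> R. Proof. by rewrite ltr0n. Qed.

Let average_const (c : R) : N%:R^-1 * \sum_(1 <= k < N.+1) c = c.
Proof.
by rewrite sumr_const_nat subn1 /= -[c *+ N]mulr_natl mulKf // gt_eqF.
Qed.

Lemma average_linear (f : Defs.point R m n -> R) :
  (forall z z', f (z + z') = f z + f z') -> (forall c z, f (c *: z) = c * f z) ->
  f avg = N%:R^-1 * \sum_(1 <= k < N.+1) f (w k).
Proof.
move=> fD fZ; have f0 : f 0 = 0.
  by rewrite -(scale0r (0 : Defs.point R m n)) fZ mul0r.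
by rewrite fZ (big_morph f fD f0).
Qed.

Lemma average_Zset : Zset avg.
Proof.
have eX i j : avg.1.1 i j = N%:R^-1 * \sum_(1 <= k < N.+1) (w k).1.1 i j.
  by apply: (@average_linear (fun z => z.1.1 i j)) => *; rewrite /= !mxE.
have eP j : avg.1.2 0 j = N%:R^-1 * \sum_(1 <= k < N.+1) (w k).1.2 0 j.
  by apply: (@average_linear (fun z => z.1.2 0 j)) => *; rewrite /= !mxE.
have eY i j : avg.2 i j = N%:R^-1 * \sum_(1 <= k < N.+1) (w k).2 i j.
  by apply: (@average_linear (fun z => z.2 i j)) => *; rewrite /= !mxE.
have Ni : 0 <= N%:R^-1 :> R by rewrite invr_ge0.
split; first apply/XsetP; first split.
- move=> i j; rewrite eX mulr_ge0 // big_nat; apply: sumr_ge0 => k kN.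
  by case: (run_Zset kN) => /XsetP[].
- move=> i; under eq_bigr => j _ do rewrite eX.
  rewrite -mulr_sumr exchange_big /= -[RHS](average_const 1); congr (_ * _).
  by rewrite !big_nat; apply: eq_bigr => k kN; case: (run_Zset kN) => /XsetP[].
- move=> j; rewrite eP mulr_ge0 // big_nat; apply: sumr_ge0 => k kN.
  by case: (run_Zset kN) => /XsetP[].
- under eq_bigr => j _ do rewrite eP.
  rewrite -mulr_sumr exchange_big /= -[RHS](average_const 1); congr (_ * _).
  by rewrite !big_nat; apply: eq_bigr => k kN; case: (run_Zset kN) => /XsetP[].
- move=> i j; rewrite eY -[X in X <= _ <= _](average_const (-1)).
  rewrite -[X in _ <= _ <= X](average_const 1) !ler_pM2l ?invr_gt0 //.
  rewrite !big_nat; apply/andP; split; apply: ler_sum => k kN;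
    by case: (run_Zset kN) => _ /(_ i j) /andP[].
Qed.

(** As F is affine in each argument, averaging points averages values exactly, and the constant
    terms are rewritten as averages of themselves. *)
Lemma average_gap_le b : Zset b ->
  F avg.1 b.2 - F b.1 avg.2 <= 2 / (eta * N%:R).
Proof.
move=> bZ.
have E1 : F avg.1 b.2 = N%:R^-1 * \sum_(1 <= k < N.+1) F (w k).1 b.2.
  rewrite /F objective_affine_x.
  rewrite (@average_linear (fun z => pdot (grad_x C b.2) z.1)); first last.
  - by move=> c u; rewrite /= pdotZr.
  - by move=> u v; rewrite /= pdotDr.
  rewrite -[X in _ + X]average_const -mulrDr -big_split /=; congr (_ * _).
  by apply: eq_bigr => k _; rewrite objective_affine_x.
have E2 : F b.1 avg.2 = N%:R^-1 * \sum_(1 <= k < N.+1) F b.1 (w k).2.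
  rewrite /F objective_affine_y.
  rewrite (@average_linear (fun z => mxdot (grad_y C q b.1) z.2)); first last.
  - by move=> c u; rewrite /= mxdotZr.
  - by move=> u v; rewrite /= mxdotDr.
  rewrite -[X in _ + X]average_const -mulrDr -big_split /=; congr (_ * _).
  by apply: eq_bigr => k _; rewrite objective_affine_y.
rewrite E1 E2 -mulrBr -sumrB.
have eta0 : 0 < eta by exact: step_size_gt0.
rewrite ler_pdivlMr ?mulr_gt0 //.
set S := \sum_(1 <= k < N.+1) _.
have -> : N%:R^-1 * S * (eta * N%:R) = eta * S by field; rewrite gt_eqF.
apply: le_trans (run_regret (leqnn N) bZ) _.
have := divZ_start_le bZ; have := divZ_ge0 bZ (run_interior (leqnn N)).
by case: run => -> _; lra.
Qed.

Lemma duality_gap_le : duality_gap F avg <= 2 / (eta * N%:R).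
Proof.
have [[sX sY] _] := start_point_interior.
(* The bound is uniform in the pair [(x, y)], so nonemptiness of both value sets, witnessed by the
   start point, suffices; no extremum need be attained. *)
rewrite /duality_gap lerBlDr; apply: ge_sup.
  by exists (F avg.1 (start_point R m n).2), (start_point R m n).2.
move=> _ [y yY <-]; rewrite addrC -lerBlDr; apply: lb_le_inf.
  by exists (F (start_point R m n).1 avg.2), (start_point R m n).1.
move=> _ [x xX <-]; have /= := @average_gap_le (x, y) (conj xX yY).
by lra.
Qed.

End Run.

(** * The program as a run of mirror prox, and its cost *)

Lemma entrywise_addE z z' : (entrywise (@Defs.cadd R) z z').1 = z + z'.
Proof.
case: z z' => [[x p] y] [[x' p'] y'] /=.
by congr (_, _, _); apply/matrixP => i j; rewrite !mxE.
Qed.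

Lemma entrywise_divE z z' (c : R) :
  (entrywise (fun s _ => Defs.cdiv s c) z z').1 = c^-1 *: z.
Proof.
case: z z' => [[x p] y] z' /=.
by congr (_, _, _); apply/matrixP => i j; rewrite !mxE mulrC.
Qed.

Definition algorithm_body (alpha beta gamma : R)
    (zS : Defs.point R m n * Defs.point R m n) :
    counted (Defs.point R m n * Defs.point R m n) :=
  bind (prox_step C q alpha beta gamma zS.1 zS.1) (fun w =>
  bind (prox_step C q alpha beta gamma w zS.1) (fun z =>
  bind (entrywise (@Defs.cadd R) zS.2 w) (fun S => ret (z, S)))).

(** The constant is 30 for each of the two prox steps and 4 for the accumulation. *)
Lemma algorithm_body_cost alpha beta gamma zS :
  ((algorithm_body alpha beta gamma zS).2 <= 64 * (m * n ^ 2))%N.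
Proof.
have P w z := prox_step_cost C q alpha beta gamma w z m_gt0 n_gt1.
rewrite /algorithm_body; move: (prox_step C q alpha beta gamma) P => f P.
rewrite 3!bind_cost entrywise_cost //=.
by have := P zS.1 zS.1; have := P (f zS.1 zS.1).1 zS.1; nia.
Qed.

Lemma algorithm_body_val zS :
  (algorithm_body (2 * (D * eta * n%:R)) (6 * (D * eta * L)) (3 * (eta * L)) zS).1 =
  (prox (prox zS.1 zS.1) zS.1, zS.2 + prox zS.1 zS.1).
Proof.
have P := prox_stepE; rewrite /algorithm_body; move: (prox_step _ _ _ _ _) P => f P.
by rewrite -entrywise_addE -!P.
Qed.

Let iterate k := iter k (fun z => prox (prox z z) z) (start_point R m n).
(** The predecessor matches the indexing of [w], which starts at 1; the value at index 0 never
    enters the average. *)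
Let half_iterate k := prox (iterate k.-1) (iterate k.-1).

Lemma iterate_interior k : interiorZ (iterate k).
Proof.
elim: k => [|k IH] /=; first exact: start_point_interior.
exact: prox_interior.
Qed.

Lemma iterate_run N : mirror_prox_run F eta N iterate half_iterate.
Proof.
split=> // k _; have iz := iterate_interior k.
by split; exact: argmin_prox.
Qed.

Lemma algorithm_output N : (mirror_prox_algorithm C q eta N).1 =
  N%:R^-1 *: \sum_(1 <= k < N.+1) half_iterate k.
Proof.
set D' := (cfold (@Defs.cmax R) (mxvec C 0)).1.
have DE : D' = max_entry C by exact: cfold_bigE.
transitivity (entrywise (fun s _ => Defs.cdiv s N%:R)
  (iter N (fun c => bind c (algorithm_body (2 * (D' * eta * n%:R))
     (6 * (D' * eta * ln n%:R)) (3 * (eta * ln n%:R))))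
    (ret (((const_mx (1 / (n * n)%:R), const_mx (1 / n%:R)), 0), 0))).1.2
  (iter N (fun c => bind c (algorithm_body (2 * (D' * eta * n%:R))
     (6 * (D' * eta * ln n%:R)) (3 * (eta * ln n%:R))))
    (ret (((const_mx (1 / (n * n)%:R), const_mx (1 / n%:R)), 0), 0))).1.2).1.
  by [].
rewrite entrywise_divE; congr (_ *: _).
rewrite iter_bind_val DE !div1r natrM -expr2 [X in iter _ _ X]/=.
rewrite (eq_iter algorithm_body_val).
set f := (fun zS => _).
suff -> : iter N f (start_point R m n, 0) =
  (iterate N, \sum_(1 <= k < N.+1) half_iterate k) by [].
elim: N => [|N IH]; first by rewrite big_geq.
by rewrite iterS IH; congr (_, _); rewrite [RHS]big_nat_recr.
Qed.

Lemma algorithm_mirror_prox_output N :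
  mirror_prox_output F eta N (mirror_prox_algorithm C q eta N).1.
Proof.
exists iterate, half_iterate; split; first exact: iterate_run.
exact: algorithm_output.
Qed.

(** Here 72 is 64 per iteration, plus 4 for the setup ([n^2] maxima and 10 scalar operations) and 4
    for the final division. The last two are charged to the iterations through [1 <= N]. *)
Lemma algorithm_cost N : (1 <= N)%N ->
  ((mirror_prox_algorithm C q eta N).2 <= 72 * (N * (m * n ^ 2)))%N.
Proof.
move=> N1.
set D' := (cfold (@Defs.cmax R) (mxvec C 0)).1.
set it := iter N (fun c => bind c (algorithm_body (2 * (D' * eta * n%:R))
     (6 * (D' * eta * ln n%:R)) (3 * (eta * ln n%:R))))
    (ret (((const_mx (1 / (n * n)%:R), const_mx (1 / n%:R)), 0), 0)).
have -> : (mirror_prox_algorithm C q eta N).2 =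
  ((cfold (@Defs.cmax R) (mxvec C 0%R)).2 + (10 + (it.2 +
    (entrywise (fun s _ => Defs.cdiv s N%:R) it.1.2 it.1.2).2)))%N by [].
have itc : (it.2 <= 0 + N * (64 * (m * n ^ 2)))%N.
  by apply: iter_bind_cost => s; exact: algorithm_body_cost.
rewrite cfold_cost entrywise_cost //.
have : (n * n + 10 <= 4 * (m * n ^ 2))%N by nia.
have : (m * (n * n) + n + m * (n + n) <= 4 * (m * n ^ 2))%N by nia.
by nia.
Qed.

End MirrorProx.

Theorem theorem4p1p3 (R : realType) :
  exists K : R, 0 < K /\
  forall (m n : nat) (C : 'M[R]_n) (q : 'M[R]_(m, n))
         (V : set (primal R m n)) (eps : R),
  (1 <= m)%N -> (2 <= n)%N ->
  (forall i j, 0 <= C i j) -> 0 < max_entry C ->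
  (forall i, simplex (row i q)) ->
  0 < eps ->
  (* V is the space on which the dual norm is taken, see dual_normX *)
  @directions R m n `<=` V ->
  smooth V (objective C q)
    0 (2 * Num.sqrt 2 * max_entry C / m%:R)
    (2 * Num.sqrt 2 * max_entry C / m%:R) 0 ->
  RX R m n = Num.sqrt (3 * m%:R * ln n%:R) ->
  RY R m n = Num.sqrt (m%:R * n%:R) ->
  let N := iterations C eps in
  let eta := step_size C in
  let algo := mirror_prox_algorithm C q eta N in
  [/\ forall uv, mirror_prox_output (objective C q) eta N uv ->
        [/\ Xset uv.1, Yset uv.2 & duality_gap (objective C q) uv <= eps],
      mirror_prox_output (objective C q) eta N algo.1 &
      1 <= iteration_bound C eps ->
        algo.2%:R <=
        K * (m%:R * n%:R ^+ 2 * Num.sqrt (n%:R * ln n%:R) * max_entry C / eps)].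
Proof.
(* 3456 is 72 times 48: 72 from [algorithm_cost], and 48 from [8 * 3 * 2], with 3 bounding the
   square root of 6 and 2 the effect of rounding up. *)
exists 3456; split; first by rewrite ltr0n.
move=> m n C q V eps m1 n2 _ D0 _ eps0 _ _ hRX hRY N eta algo.
have L0 : 0 < ln n%:R :> R by rewrite ln_gt0 // ltr1n.
have n0 : 0 < n%:R :> R by rewrite ltr0n; lia.
set B := iteration_bound C eps.
have r0 : 0 < Num.sqrt (6 * n%:R * ln n%:R) :> R by rewrite sqrtr_gt0 !mulr_gt0.
have B0 : 0 < B by rewrite divr_gt0 // !mulr_gt0.
have NE : N%:R = (Num.ceil B)%:~R :> R.
  by rewrite /N /iterations natr_absz gtr0_norm // ceil_gt0.
have /andP[NltB BleN] := ceil_itv B.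
rewrite -NE in BleN; rewrite intrB -NE in NltB.
have N0 : (0 < N)%N by rewrite -(ltr0n R); lra.
split.
- move=> _ [z [w [run ->]]].
  have [X Y] := average_Zset m1 n2 D0 hRX hRY run N0.
  split=> //; apply: le_trans (duality_gap_le m1 n2 D0 hRX hRY run N0) _.
  have e0 := step_size_gt0 m1 n2 D0.
  rewrite ler_pdivrMr ?mulr_gt0 ?ltr0n //.
  (* The real iteration bound is exactly [2 / (eta * eps)], where 2 bounds the initial
     divergence. *)
  have -> : 2 = eps * (eta * B).
    rewrite /eta /B /step_size /iteration_bound; field.
    by rewrite !gt_eqF.
  by rewrite ler_pM2l // ler_pM2l.
- exact: algorithm_mirror_prox_output.
- move=> B1.
  have cost : algo.2%:R <= 72 * (N%:R * (m%:R * n%:R ^+ 2)) :> R.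
    by rewrite -natrX -!natrM ler_nat; exact: algorithm_cost.
  have r3 : Num.sqrt (6 * n%:R * ln n%:R) <= 3 * Num.sqrt (n%:R * ln n%:R) :> R.
    rewrite -(ler_pXn2r (ltn0Sn 1)) ?nnegrE ?mulr_ge0 ?sqrtr_ge0 //.
    rewrite exprMn !sqr_sqrtr ?mulr_ge0 // ?ltW //.
    by have := mulr_gt0 n0 L0; lra.
  set s := Num.sqrt (n%:R * _) in r3 *.
  have BE : B <= 24 * (s * max_entry C / eps).
    rewrite mulrA ler_pM2r ?invr_gt0 // mulrAC mulrA ler_pM2r //; lra.
  (* Rounding up at most doubles: [N < B + 1 <= 2 B] by [B1]. *)
  have N2 : N%:R <= 48 * (s * max_entry C / eps) by lra.
  apply: (le_trans cost); set M := m%:R * n%:R ^+ 2.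
  have M0 : 0 <= M by rewrite mulr_ge0 ?exprn_ge0.
  have := ler_wpM2r M0 N2.
  have -> : 48 * (s * max_entry C / eps) * M = 48 * (M * s * max_entry C / eps).
    by ring.
  by lra.
Qed.
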